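(* Let $d\in\mathbb{N}$. In the fixed design regression setting on the simplex described in the context, suppose that Assumptions (A1)--(A4) listed in the context hold. Then, as $n\to\infty$ and uniformly in $\boldsymbol{s}\in\mathcal{S}_d$, $$\mathsf{Bias}\{\hat m_{n,b}^{\mathrm{GM}}(\boldsymbol{s})\}=\mathsf{E}\{\hat m_{n,b}^{\mathrm{GM}}(\boldsymbol{s})\}-m(\boldsymbol{s})=b\,g(\boldsymbol{s})+\mathrm{o}(b),$$ where $$g(\boldsymbol{s})=\sum_{j=1}^d\{1-(d+1)s_j\}\frac{\partial}{\partial s_j}m(\boldsymbol{s})+\frac12\sum_{j,k=1}^d s_j(\mathbf{1}_{\{j=k\}}-s_k)\frac{\partial^2}{\partial s_j\partial s_k}m(\boldsymbol{s}).$$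
   Context: Notation. $\mathcal{S}_d=\{\boldsymbol{s}\in[0,1]^d:\|\boldsymbol{s}\|_1\le 1\}$, $\mathrm{Int}(\mathcal{S}_d)=\{\boldsymbol{s}\in(0,1)^d:\|\boldsymbol{s}\|_1<1\}$, with $\|\cdot\|_1$ the $\ell^1$ norm; $[n]=\{1,\dots,n\}$; $\mathrm{Leb}$ is Lebesgue measure on $\mathbb{R}^d$. For $\boldsymbol{\alpha}\in(0,\infty)^d$, $\beta\in(0,\infty)$, the $\mathrm{Dirichlet}(\boldsymbol{\alpha},\beta)$ density on $\mathcal{S}_d$ is $$K_{\boldsymbol{\alpha},\beta}(\boldsymbol{s})=\frac{\Gamma(\|\boldsymbol{\alpha}\|_1+\beta)}{\Gamma(\beta)\prod_{j=1}^d\Gamma(\alpha_j)}(1-\|\boldsymbol{s}\|_1)^{\beta-1}\prod_{j=1}^d s_j^{\alpha_j-1}.$$ For $\boldsymbol{s}\in\mathcal{S}_d$ and $b\in(0,\infty)$ put $\kappa_{\boldsymbol{s},b}=K_{\boldsymbol{s}/b+\boldsymbol{1},\,(1-\|\boldsymbol{s}\|_1)/b+1}$, with $\boldsymbol{1}=(1,\dots,1)$. Setting. For each $n$ there are deterministic design points $\boldsymbol{x}_1,\dots,\boldsymbol{x}_n\in\mathrm{Int}(\mathcal{S}_d)$ (depending on $n$; the dependence is suppressed), with design density $f$, a probability density on $\mathcal{S}_d$: for every Borel set $B\subseteq\mathbb{R}^d$ with $\mathrm{Leb}(\partial B)=0$, $\lim_{n\to\infty}\frac1n\sum_{i=1}^n\mathbf{1}_B(\boldsymbol{x}_i)=\int_B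 f(\boldsymbol{x})\,d\boldsymbol{x}$. The responses are $Y_i=m(\boldsymbol{x}_i)+\varepsilon_i$, $i\in[n]$, where $m:\mathcal{S}_d\to\mathbb{R}$ and, for each $n$, the errors $\varepsilon_1,\dots,\varepsilon_n$ are mutually independent with $\varepsilon_i$ of mean zero and variance $\sigma^2(\boldsymbol{x}_i)$. Given a smoothing parameter $b=b(n)\in(0,\infty)$ and sets $B_1,\dots,B_n$ (depending on $n$) as in (A4) below, the Dirichlet-kernel Gasser--Müller estimator is $$\hat m_{n,b}^{\mathrm{GM}}(\boldsymbol{s})=\sum_{i=1}^n Y_i\int_{B_i}\kappa_{\boldsymbol{s},b}(\boldsymbol{x})\,d\boldsymbol{x},\qquad\boldsymbol{s}\in\mathcal{S}_d.$$ Assumptions. (A1) $f$ and $\sigma^2$ are Lipschitz continuous on $\mathcal{S}_d$, and $m$ is twice continuously differentiable on $\mathcal{S}_d$ (in particular $\sigma^2$ is bounded on $\mathcal{S}_d$). (A2) $\min_{\mathcal{S}_d}f>0$ and $\min_{\mathcal{S}_d}\sigma^2>0$. (A3) $b=b(n)\to0$ and $n^{-1/d}=\mathrm{o}(b)$ as $n\to\infty$. (A4) For every $n\in\mathbb{N}$, $B_1,\dots,B_n$ are convex compact subsets of $\mathcal{S}_d$ such that: (a) $\mathrm{Int}(B_i)\cap\mathrm{Int}(B_j)=\emptyset$ for $i\ne j$ and $B_1\cup\dots\cup B_n=\mathcal{S}_d$; (b) $\boldsymbol{x}_i\in\mathrm{Int}(B_i)$ for every $i\in[n]$; (c) $\mathrm{Leb}(\partial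 B_i)=0$ for every $i\in[n]$; (d) $\mathrm{diam}(B_i)=\mathcal{O}(n^{-1/d})$ uniformly in $i$ as $n\to\infty$; (e) $|\int_{B_i}f(\boldsymbol{t})\,d\boldsymbol{t}-n^{-1}|=\mathcal{O}(n^{-1-1/d})$ uniformly in $i$ as $n\to\infty$. *)

(* Defs.v *)
From HB Require Import structures.
From mathcomp Require Import all_boot all_order all_algebra.
From mathcomp Require Import all_classical all_reals all_analysis.
From mathcomp Require Import measurable_realfun.

Set Implicit Arguments.
Unset Strict Implicit.
Unset Printing Implicit Defensive.

Import Order.TTheory GRing.Theory Num.Theory.
Import numFieldNormedType.Exports.

Local Open Scope classical_set_scope.
Local Open Scope ring_scope.

(* R^d is ['rV[R]_d], with the sigma-algebra generated by the coordinates; for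
   the standard topology this is the Borel sigma-algebra ([measurable_rVE]). *)
Section measurable_rV.
Context {disp : measure_display} {T : measurableType disp} {n : nat}.

Let coord : 'I_n -> 'rV[T]_n -> T := fun i v => v ord0 i.

Let rV_set0 : g_sigma_preimage coord set0.
Proof. exact: sigma_algebra0. Qed.

Let rV_setC A : g_sigma_preimage coord A -> g_sigma_preimage coord (~` A).
Proof. exact: sigma_algebraC. Qed.

Let rV_bigcup (F : (set 'rV[T]_n)^nat) :
  (forall i, g_sigma_preimage coord (F i)) ->
  g_sigma_preimage coord (\bigcup_i (F i)).
Proof. exact: sigma_algebra_bigcup. Qed.

HB.instance Definition _ := @isMeasurable.Build (measure_tuple_display disp)
  'rV[T]_n (g_sigma_preimage coord) rV_set0 rV_setC rV_bigcup.

End measurable_rV.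

Lemma measurable_rV_coord {disp} {T : measurableType disp} {n} (i : 'I_n) :
  measurable_fun [set: 'rV[T]_n] (fun v : 'rV[T]_n => v ord0 i).
Proof.
move=> _ Y mY; rewrite setTI; apply: sub_sigma_algebra => /=.
rewrite -bigcup_seq/=; exists i => /=; first by rewrite mem_index_enum.
by exists Y => //; rewrite setTI.
Qed.

Lemma measurable_fun_rVP {d1 d2} {T1 : measurableType d1}
    {T2 : measurableType d2} {n} (f : T1 -> 'rV[T2]_n) :
  (forall i, measurable_fun [set: T1] (fun x => f x ord0 i)) ->
  measurable_fun [set: T1] f.
Proof.
move=> mf.
have sub : g_sigma_preimage (fun i x => f x ord0 i) `<=` measurable.
  apply: smallest_sub; first exact: sigma_algebra_measurable.
  case: n => [|n] in f mf *; first by rewrite big_ord0.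
  rewrite -bigcup_mkord_ord; apply: bigcup_sub => i Ii.
  by move=> A [B mB <-]; exact: mf.
move=> _ A mA; apply: sub.
rewrite (_ : g_sigma_preimage _ = preimage_set_system [set: T1] f
  (g_sigma_preimage (fun i (v : 'rV[T2]_n) => v ord0 i))).
  by exists A.
rewrite -g_sigma_preimageE; congr (<<s _ >>).
rewrite (big_morph _ (preimage_set_systemU _ _) (preimage_set_system0 _ _)).
by apply: eq_bigr => i _; rewrite -preimage_set_system_comp.
Qed.

Section borel_rV.
Context {R : realType} {d : nat}.

Lemma open_measurable_rV (A : set 'rV[R]_d) : open A -> measurable A.
Proof.
move=> oA.
pose U (q : 'rV[rat]_d * nat) : set 'rV[R]_d :=
  [set v | forall j, `|ratr (q.1 ord0 j) - v ord0 j| < q.2.+1%:R^-1].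
have mU q : measurable (U q).
  rewrite (_ : U q = \bigcap_(j in [set: 'I_d])
      ((fun v : 'rV[R]_d => v ord0 j) @^-1`
       ball (ratr (q.1 ord0 j) : R) q.2.+1%:R^-1)).
    apply: fin_bigcap_measurable => // j _.
    rewrite -[X in measurable X]setTI; apply: measurable_rV_coord => //.
    apply: measurable_ball.
  apply/seteqP; split => v /= h j; last exact: (h j I).
  by move=> _; exact: h.
rewrite (_ : A = \bigcup_(q in [set q | U q `<=` A]) U q).
  rewrite bigcup_mkcond; apply: countable_bigcupT_measurable => //.
  by move=> q; case: ifPn.
apply/seteqP; split => [v Av|v [q /= qA qv]]; last exact: qA.
have /nbhs_ballP[e /= e0 veA] : nbhs v A by apply: open_nbhs_nbhs; split.
have [k ke] : exists k : nat, (k.+1%:R^-1 : R) < e / 2.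
  have e20 : 0 < e / 2 by rewrite divr_gt0.
  have [N _ Nk] := near_infty_natSinv_lt (PosNum e20).
  by exists N; exact: (Nk N (leqnn N)).
have /choice[q qv] : forall j : 'I_d, exists q : rat,
    `|ratr q - v ord0 j| < k.+1%:R^-1.
  move=> j.
  have [|q] := @rat_in_itvoo R (v ord0 j) (v ord0 j + k.+1%:R^-1).
    by rewrite ltrDl invr_gt0.
  rewrite in_itv/= => /andP[vq qv]; exists q.
  by rewrite gtr0_norm ?subr_gt0// ltrBlDl.
exists (\row_j q j, k) => /=; last by move=> j /=; rewrite mxE; exact: qv.
move=> w Uw; apply: veA; split => // i j; rewrite (ord1 i) /ball/=.
have := Uw j; rewrite /= mxE => wq.
rewrite (splitr e) (le_lt_trans (ler_distD (ratr (q j)) _ _))//.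
rewrite ltrD// ?(lt_trans _ ke)//.
by rewrite distrC; exact: qv.
Qed.

Lemma measurable_rVE : @measurable _ 'rV[R]_d = <<s @open 'rV[R]_d >>.
Proof.
apply/seteqP; split.
  apply: smallest_sub; first exact: smallest_sigma_algebra.
  rewrite -bigcup_seq; apply: bigcup_sub => i _ A [B mB <-].
  have : measurable_fun [set: g_sigma_algebraType (@open 'rV[R]_d)]
      (fun v : 'rV[R]_d => v ord0 i : R).
    apply: (measurability _ (RGenOpens.measurableE R)) => _ [_ [x [y ->]] <-].
    apply: sub_sigma_algebra; rewrite setTI.
    apply: open_comp => [? _|]; [exact: coord_continuous|exact: itv_open].
  exact.
apply: smallest_sub; first exact: sigma_algebra_measurable.
exact: open_measurable_rV.
Qed.

End borel_rV.

(* d-dimensional Lebesgue measure by sections: the measure of A is the integral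
   over the first coordinate t of the (d-1)-dimensional measure of the section
   of A at t; see [lebesgue_rV_box]. *)
Fixpoint lebesgue_rV (R : realType) (d : nat) : set 'rV[R]_d -> \bar R :=
  match d with
  | 0 => fun A => \d_(0 : 'rV[R]_0) A
  | d'.+1 => fun A => (\int[@lebesgue_measure R]_t
      lebesgue_rV [set v : 'rV[R]_d' | A (row_mx (t%:M : 'rV_1) v)])%E
  end.

(* Sigma-finiteness of [m1 \x m2] is reproved here because the instance of the
   library is shadowed by the one for finite measures. *)
Lemma pushforward_product_sigma_finite {R : realType} {d1 d2 d3}
    {T1 : measurableType d1} {T2 : measurableType d2} {T3 : measurableType d3}
    (m1 : {sigma_finite_measure set T1 -> \bar R})
    (m2 : {sigma_finite_measure set T2 -> \bar R})
    (f : T1 * T2 -> T3) (g : T3 -> T1 * T2) :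
  measurable_fun setT f -> measurable_fun setT g -> cancel f g ->
  exists mu : {sigma_finite_measure set T3 -> \bar R},
    (mu : set T3 -> \bar R) = pushforward (m1 \x m2)%E f.
Proof.
move=> mf mg fK; set mu' := pushforward _ _.
have [F FT Ffin] : sigma_finite setT (m1 \x m2)%E.
  have /sigma_finiteP[F [TF ndF Foo]] := sigma_finiteT m1.
  have /sigma_finiteP[G [TG ndG Goo]] := sigma_finiteT m2.
  exists (fun n => F n `*` G n).
    rewrite -setXTT TF TG predeqE => -[x y]; split.
      move=> [/= [n _ Fnx] [k _ Gky]]; exists (maxn n k) => //; split.
      - by move: x Fnx; exact/subsetPset/ndF/leq_maxl.
      - by move: y Gky; exact/subsetPset/ndG/leq_maxr.
    by move=> [n _ []/= ? ?]; split; exists n.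
  move=> k; have [? ?] := Foo k; have [? ?] := Goo k.
  split; first exact: measurableX.
  by rewrite product_measure1E// lte_mul_pinfty// ge0_fin_numE.
have sf : sigma_finite setT mu'.
  exists (fun k => g @^-1` F k).
    by rewrite -preimage_bigcup -FT preimage_setT.
  move=> k; have [mF Fk] := Ffin k; split.
    by rewrite -[X in measurable X]setTI; exact: mg.
  rewrite /mu' /pushforward -comp_preimage.
  by rewrite (_ : _ \o _ = id)//; apply/funext => p /=; rewrite fK.
pose M1 : {measure set T3 -> \bar R} :=
  [the measure _ _ of pushforward (m1 \x m2)%E f].
pose isS := Measure_isSigmaFinite.Build _ _ _ (M1 mf) sf.
pose M : {sigma_finite_measure set T3 -> \bar R} := HB.pack mu' (M1 mf) isS.
by exists (M mf).
Qed.

Lemma row_mx_rV0 (R : pzRingType) d (t : R) (v : 'rV[R]_d) :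
  (row_mx (t%:M : 'rV_1) v : 'rV_d.+1) ord0 ord0 = t.
Proof.
have := row_mxEl (t%:M : 'rV[R]_1) v ord0 ord0.
rewrite [RHS]mxE eqxx mulr1n => tE; rewrite -[RHS]tE.
by congr (row_mx _ _ _ _); exact/val_inj.
Qed.

Lemma row_mx_rVS (R : pzRingType) d (t : R) (v : 'rV[R]_d) j :
  (row_mx (t%:M : 'rV_1) v : 'rV_d.+1) ord0 (lift ord0 j) = v ord0 j.
Proof.
rewrite -[RHS](row_mxEr (t%:M : 'rV[R]_1)).
by congr (row_mx _ _ _ _); exact/val_inj.
Qed.

Section lebesgue_rV_measure.
Context {R : realType}.

Let cons_rV d (p : measurableTypeR R * 'rV[R]_d) : 'rV[R]_d.+1 :=
  row_mx (p.1%:M : 'rV_1) p.2.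

Let uncons_rV d (v : 'rV[R]_d.+1) : measurableTypeR R * 'rV[R]_d :=
  (v ord0 ord0, \row_j v ord0 (lift ord0 j)).

Let cons_rV0 d (p : measurableTypeR R * 'rV[R]_d) : cons_rV p ord0 ord0 = p.1.
Proof. exact: row_mx_rV0. Qed.

Let cons_rVS d (p : measurableTypeR R * 'rV[R]_d) j :
  cons_rV p ord0 (lift ord0 j) = p.2 ord0 j.
Proof. exact: row_mx_rVS. Qed.

Let uncons_rVK d : cancel (@uncons_rV d) (@cons_rV d).
Proof.
move=> v; apply/rowP => i.
by case: (unliftP ord0 i) => [j|] ->; rewrite ?cons_rV0 ?cons_rVS//= mxE.
Qed.

Let cons_rVK d : cancel (@cons_rV d) (@uncons_rV d).
Proof.
move=> p; rewrite /uncons_rV cons_rV0 [RHS]surjective_pairing; congr (_, _).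
by apply/rowP => j; rewrite mxE cons_rVS.
Qed.

Let measurable_cons_rV d : measurable_fun setT (@cons_rV d).
Proof.
apply: measurable_fun_rVP => i.
case: (unliftP ord0 i) => [j|] ->.
  under eq_fun do rewrite cons_rVS.
  by apply: (measurableT_comp (@measurable_rV_coord _ R d j)).
under eq_fun do rewrite cons_rV0.
exact: measurable_fst.
Qed.

Let measurable_uncons_rV d : measurable_fun setT (@uncons_rV d).
Proof.
apply: measurable_fun_pair; first exact: measurable_rV_coord.
apply: measurable_fun_rVP => i.
under eq_fun do rewrite mxE.
exact: measurable_rV_coord.
Qed.

Let lebesgue_rV_exists d : exists mu : {sigma_finite_measure set 'rV[R]_d -> \bar R},
  (mu : set _ -> \bar R) = @lebesgue_rV R d.
Proof.
elim: d => [|d [mu muE]].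
  by exists (\d_(0 : 'rV[R]_0)).
have [mu' mu'E] := pushforward_product_sigma_finite
  (@lebesgue_measure R) mu (@measurable_cons_rV d) (@measurable_uncons_rV d)
  (@cons_rVK d).
exists mu'; rewrite mu'E; apply/funext => A.
rewrite /pushforward /product_measure1 /=.
apply: eq_integral => t _ /=; rewrite muE; congr (lebesgue_rV _).
by apply/seteqP; split => v; rewrite /xsection /= in_setE.
Qed.

Let lebesgue_rV0 d : @lebesgue_rV R d set0 = 0%E.
Proof. by have [mu <-] := lebesgue_rV_exists d; exact: measure0. Qed.

Let lebesgue_rV_ge0 d A : (0 <= @lebesgue_rV R d A)%E.
Proof. by have [mu <-] := lebesgue_rV_exists d; exact: measure_ge0. Qed.

Let lebesgue_rV_sigma_additive d : semi_sigma_additive (@lebesgue_rV R d).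
Proof.
by have [mu <-] := lebesgue_rV_exists d; exact: measure_semi_sigma_additive.
Qed.

HB.instance Definition _ d := isMeasure.Build _ _ _ (@lebesgue_rV R d)
  (@lebesgue_rV0 d) (@lebesgue_rV_ge0 d) (@lebesgue_rV_sigma_additive d).

Let lebesgue_rV_sigma_finite d : sigma_finite setT (@lebesgue_rV R d).
Proof. by have [mu <-] := lebesgue_rV_exists d; exact: sigma_finiteT. Qed.

HB.instance Definition _ d := Measure_isSigmaFinite.Build _ _ _ (@lebesgue_rV R d)
  (@lebesgue_rV_sigma_finite d).

End lebesgue_rV_measure.

Lemma lebesgue_rV_box (R : realType) d (A : 'I_d -> set R) :
  (forall j, measurable (A j)) ->
  lebesgue_rV [set v : 'rV[R]_d | forall j, A j (v ord0 j)] =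
  (\prod_(j < d) lebesgue_measure (A j))%E.
Proof.
elim: d A => [|d ih] A mA.
  rewrite big_ord0 /= diracE mem_set//; first by move=> [].
rewrite big_ord_recl /= -ih => [|j]; last exact: mA.
set c := lebesgue_rV _.
transitivity (\int[@lebesgue_measure R]_t ((\1_(A ord0) t)%:E * c))%E; last first.
  have c0 : (0 <= c)%E by exact: measure_ge0.
  rewrite ge0_integralZr ?integral_indic ?setIT//.
    exact: mA.
  by apply: measurableT_comp => //; apply: measurable_indic; exact: mA.
apply: eq_integral => t _; rewrite indicE.
have [|] := boolP (t \in A ord0); rewrite ?inE ?notin_setE => At.
  rewrite mul1e; congr lebesgue_rV; apply/seteqP; split => v /= Av j.
    by rewrite -(row_mx_rVS t v); exact: Av.
  by case: (unliftP ord0 j) => [k|] ->; rewrite ?row_mx_rVS ?row_mx_rV0.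
rewrite mul0e (_ : [set _ | _] = set0) ?measure0//.
by apply/seteqP; split => // v /= /(_ ord0); rewrite row_mx_rV0.
Qed.

Section simplex.
Context {R : realType} {d : nat}.
Implicit Types (s x alpha : 'rV[R]_d) (A : set 'rV[R]_d).

Definition l1norm s : R := \sum_(j < d) `|s ord0 j|.

Definition l2norm s : R := Num.sqrt (\sum_(j < d) s ord0 j ^+ 2).

Definition diam A : R := sup [set l2norm (x - y) | x in A & y in A].

Definition boundary A : set 'rV[R]_d := closure A `\` A°.

Definition simplex : set 'rV[R]_d :=
  [set s : 'rV[R]_d | (forall j, 0 <= s ord0 j <= 1) /\ l1norm s <= 1].

Definition int_simplex : set 'rV[R]_d :=
  [set s : 'rV[R]_d | (forall j, 0 < s ord0 j < 1) /\ l1norm s < 1].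

(* Continuous differentiability up to the boundary of the simplex: the function
   is differentiable on the interior and its first partial derivatives have
   limits at every point of the simplex. [simplex_partial j h] is the resulting
   extension of the j-th partial derivative of h to the whole simplex; it only
   depends on the values of h on the interior. *)
Definition simplex_partial (j : 'I_d) (h : 'rV[R]_d -> R) s : R :=
  lim ('D_(delta_mx ord0 j) h y @[y --> within int_simplex (nbhs s)]).

Definition simplex_C1 (h : 'rV[R]_d -> R) : Prop :=
  [/\ {within simplex, continuous h},
      forall s, int_simplex s -> differentiable h s &
      forall j s, simplex s ->
        cvg ('D_(delta_mx ord0 j) h y @[y --> within int_simplex (nbhs s)])].

Definition simplex_C2 (h : 'rV[R]_d -> R) : Prop :=
  simplex_C1 h /\ forall j, simplex_C1 (simplex_partial j h).

Definition Gamma (a : R) : R :=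
  \int[@lebesgue_measure R]_(t in `]0%R, +oo[%classic)
    (t `^ (a - 1) * expR (- t)).

(* On the boundary of the simplex, a zero base with a zero exponent contributes
   1 and a zero base with any other exponent contributes 0 (convention of
   [powR]); this only concerns a Lebesgue-null set. *)
Definition dirichlet_pdf alpha (beta : R) s : R :=
  Gamma (l1norm alpha + beta) / (Gamma beta * \prod_(j < d) Gamma (alpha ord0 j))
  * (1 - l1norm s) `^ (beta - 1) * \prod_(j < d) s ord0 j `^ (alpha ord0 j - 1).

Definition dirichlet_kernel s (b : R) : 'rV[R]_d -> R :=
  dirichlet_pdf (b^-1 *: s + const_mx 1) ((1 - l1norm s) / b + 1).

(* Functions on the simplex are represented by total functions on R^d whose
   values outside the simplex are irrelevant; hence the density is integrated
   over the intersection with the simplex. *)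
Definition design_density (x : forall n, 'I_n -> 'rV[R]_d)
    (f : 'rV[R]_d -> R) : Prop :=
  [/\ forall s, simplex s -> 0 <= f s,
      \int[@lebesgue_rV R d]_(t in simplex) f t = 1 &
      forall A, measurable A -> lebesgue_rV (boundary A) = 0%E ->
        n%:R^-1 * (\sum_(i < n) \1_A (x n i)) @[n --> \oo] -->
        (\int[@lebesgue_rV R d]_(t in A `&` simplex) f t : R)].

Definition gm_estimator n (b : R) (B : 'I_n -> set 'rV[R]_d) (Y : 'I_n -> R) s
    : R :=
  \sum_(i < n) Y i * \int[@lebesgue_rV R d]_(t in B i) dirichlet_kernel s b t.

Definition gm_bias_coef (m : 'rV[R]_d -> R) s : R :=
  \sum_(j < d) (1 - d.+1%:R * s ord0 j) * simplex_partial j m s +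
  2^-1 * \sum_(j < d) \sum_(k < d) s ord0 j * ((j == k)%:R - s ord0 k) *
    simplex_partial j (simplex_partial k m) s.

End simplex.

Definition mutually_independent {disp : measure_display}
    {Omega : measurableType disp} {R : realType} (P : probability Omega R)
    {n : nat} (X : 'I_n -> Omega -> R) : Prop :=
  forall (J : {set 'I_n}) (A : 'I_n -> set R), (forall i, measurable (A i)) ->
    P (\bigcap_(i in [set` J]) (X i @^-1` A i)) =
    (\prod_(i in J) P (X i @^-1` A i))%E.

(* Main.v *)
(* The errors are centred, so the mean of the estimator is
   sum_i m(x_i) int_{B_i} kappa_{s,b}.  Let P be the second-order Taylor polynomial of
   m at s.  Integrating P against the kernel only involves the mean and covariance of
   a Dirichlet law, which give m(s) + b g(s) + O(b^2) uniformly in s.  The cells have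
   disjoint interiors covering the simplex up to a null set, so the mean of the
   estimator minus int P kappa is the integral of m(x_i) - P(t), for t in the interior
   of B_i, against the kernel.  There |m(x_i) - m(t)| is O(n^{-1/d}) = o(b) as m is
   Lipschitz on the interior, and for every e > 0 the uniform continuity of the second
   derivatives yields |m(t) - P(t)| <= e |t - s|^2 + C_e |t - s|^4, whose integral is
   at most e O(b) + C_e O(b^2).

   All moments follow from t_j K_{alpha,beta}(t) =
   alpha_j / (|alpha| + beta) K_{alpha + e_j,beta}(t) together with int K = 1; the latter
   is obtained by induction on d, since convolving two powers produces a Beta
   integral.  In the Taylor bound t is an interior point, so that the open segment from
   s to t stays in the interior even when s lies on the boundary. *)
Require Import Defs.
From HB Require Import structures.
From mathcomp Require Import all_boot all_order all_algebra.
From mathcomp Require Import all_classical all_reals all_analysis.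
From mathcomp Require Import measurable_realfun ring lra.

Set Implicit Arguments.
Unset Strict Implicit.
Unset Printing Implicit Defensive.

Import Order.TTheory GRing.Theory Num.Theory.
Import numFieldNormedType.Exports.

Local Open Scope classical_set_scope.
Local Open Scope ring_scope.

(** * Beta and Gamma integrals *)

Section affine.
Context {R : realType}.
Local Notation mu := (@lebesgue_measure R).
Implicit Types (k c : R).

Let affine k c (t : measurableTypeR R) : measurableTypeR R := k * t + c.

Let measurable_affine k c : measurable_fun setT (affine k c).
Proof. by apply: measurable_funD. Qed.

(* The instance is named explicitly because its measurability premise cannot be
   found by unification. *)
Let pushforward_affine k c : {measure set measurableTypeR R -> \bar R} :=
  measure_function_pushforward__canonical__measure_function_Measure mu
    (measurable_affine k c).

(** By uniqueness of Lebesgue measure, it is enough that [k] times the image measure gives every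
    half-open interval its length. *)
Lemma lebesgue_measure_affine k c (A : set (measurableTypeR R)) :
  0 < k -> measurable A ->
  (mu ((fun t => k * t + c)%R @^-1` A) = k^-1%:E * mu A)%E.
Proof.
move=> k0 mA.
have k'0 : 0 <= k by exact: ltW.
pose nu : {measure set measurableTypeR R -> \bar R} :=
  mscale (NngNum k'0) (pushforward_affine k c).
have -> : mu A = nu A.
  apply: lebesgue_measure_unique => // _ [[x y] /= _ <-].
  rewrite /mscale /= /pushforward.
  rewrite (_ : _ @^-1` _ = `]((x - c) / k), ((y - c) / k)]%classic); last first.
    apply/seteqP; split => t /=;
      by rewrite !in_itv/= ltr_pdivrMr// ler_pdivlMr// ltrBlDr lerBrDr (mulrC t).
  rewrite !lebesgue_measure_itv/= !lte_fin ltr_pM2r ?invr_gt0// ltrD2r.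
  case: ifPn => _; last by rewrite mule0.
  rewrite -!EFinB -EFinM; congr EFin; field; exact: lt0r_neq0.
rewrite /= /mscale /= muleA -EFinM mulVf ?mul1e//; exact: lt0r_neq0.
Qed.

Lemma ge0_integral_affine k c (F : R -> \bar R) : 0 < k -> measurable_fun setT F ->
  (forall t, (0 <= F t)%E) ->
  (\int[mu]_t F t = k%:E * \int[mu]_t F (k * t + c)%R)%E.
Proof.
move=> k0 mF F0.
have k'0 : 0 <= k by exact: ltW.
pose nu : {measure set measurableTypeR R -> \bar R} :=
  mscale (NngNum k'0) (pushforward_affine k c).
transitivity (\int[nu]_t F t)%E.
  apply: eq_measure_integral => A mA _.
  transitivity (k%:E * mu (affine k c @^-1` A))%E; last by [].
  rewrite lebesgue_measure_affine// muleA -EFinM mulfV ?mul1e//; exact: lt0r_neq0.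
rewrite ge0_integral_mscale//=; congr (_ * _)%E.
by rewrite (ge0_integral_pushforward (measurable_affine k c))//; move=> t _.
Qed.

End affine.

Section ppow.
Context {R : realType}.
Local Notation mu := (@lebesgue_measure R).
Implicit Types (a q t u c : R).

(* [powR] is 1 at negative bases, hence the indicator; thanks to it the product of
   the [ppow] in [dir_mon] below vanishes off the simplex. *)
Definition ppow a t : R := \1_(`[0, +oo[%classic) t * t `^ (a - 1).

Lemma ppow_ge0 a t : 0 <= ppow a t.
Proof. by rewrite /ppow mulr_ge0 ?powR_ge0// indicE. Qed.

Lemma ppowE a t : 0 <= t -> ppow a t = t `^ (a - 1).
Proof. by move=> t0; rewrite /ppow indicE mem_set ?mul1r//= in_itv/= t0. Qed.

Lemma ppow_lt0 a t : t < 0 -> ppow a t = 0.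
Proof.
move=> t0; rewrite /ppow indicE memNset ?mul0r//= in_itv/= andbT.
by apply/negP; rewrite -ltNge.
Qed.

Lemma measurable_ppow a : measurable_fun setT (ppow a).
Proof.
apply: measurable_funM; last exact: measurable_powR.
exact: measurable_indic.
Qed.

Lemma ppow_scale a k t : 0 < k -> ppow a (k * t) = k `^ (a - 1) * ppow a t.
Proof.
move=> k0; have [t0|t0] := leP 0 t.
  by rewrite !ppowE ?mulr_ge0 ?(ltW k0)// powRM// ltW.
by rewrite !ppow_lt0 ?mulr0// nmulr_llt0.
Qed.

Lemma ppow_mul a t : 1 <= a -> t * ppow a t = ppow (a + 1) t.
Proof.
move=> a1; have [t0|t0] := leP 0 t; last by rewrite !ppow_lt0 ?mulr0.
by rewrite !ppowE// mulr_powRB1 ?addrK// (lt_le_trans ltr01).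
Qed.

(** The Beta function, integrated over the whole line: the two [ppow] factors confine the integrand
    to [0, 1]. *)
Definition beta_int a q : \bar R := (\int[mu]_t (ppow a t * ppow q (1 - t))%:E)%E.

Let mB a q c : measurable_fun setT (fun t => ppow a t * ppow q (c - t)).
Proof.
apply: measurable_funM; first exact: measurable_ppow.
apply: (measurableT_comp (measurable_ppow q)).
by apply: measurable_funB.
Qed.

(** For [c > 0], substituting [c * t] for [t] pulls out the power [(a - 1) + (q - 1) + 1] of [c].
    For [c < 0] one of the two factors always vanishes. *)
Lemma ppow_convolution a q c : 1 <= a -> 1 <= q ->
  (\int[mu]_t (ppow a t * ppow q (c - t))%:E = beta_int a q * (ppow (a + q) c)%:E)%E.
Proof.
move=> a1 q1.
have [c0|c0|->] := ltgtP c 0.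
- rewrite ppow_lt0// mule0; apply: integral0_eq => t _.
  have [t0|t0] := ltP t 0; first by rewrite ppow_lt0 ?mul0r.
  by rewrite (ppow_lt0 q) ?mulr0// subr_lt0 (lt_le_trans c0).
- rewrite (@ge0_integral_affine _ c 0)//; last 2 first.
  + by apply/measurable_EFinP; exact: mB.
  + by move=> t; rewrite lee_fin mulr_ge0 ?ppow_ge0.
  rewrite -muleC.
  transitivity ((\int[mu]_t ((c `^ (a - 1) * c `^ (q - 1))%:E *
    (ppow a t * ppow q (1 - t))%:E)) * c%:E)%E.
    congr (_ * _)%E; apply: eq_integral => t _.
    rewrite addr0 (_ : c - c * t = c * (1 - t)); last by ring.
    by rewrite !ppow_scale// -EFinM; congr EFin; ring.
  rewrite ge0_integralZl//=; last 3 first.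
  + by apply/measurable_EFinP; exact: mB.
  + by move=> t _; rewrite lee_fin mulr_ge0 ?ppow_ge0.
  + by rewrite lee_fin mulr_ge0 ?powR_ge0.
  rewrite -/(beta_int a q) muleC muleA -EFinM muleC; congr (_ * _%:E)%E.
  rewrite ppowE ?(ltW c0)// -powRD; last by rewrite (gt_eqF c0) implybT.
  rewrite -[X in X * _]powRr1 ?(ltW c0)// -powRD; last by rewrite (gt_eqF c0) implybT.
  by congr (_ `^ _); ring.
- rewrite ppowE// powR0 ?mule0; last by rewrite gt_eqF//; lra.
  (* At [c = 0] only [t = 0] can contribute, with value 1 when [a = q = 1] since 0 to the power 0 is
     1; the integral vanishes because a singleton is null. *)
  rewrite (_ : (fun t : R => _) =
      (fun t => ((ppow a t * ppow q (0 - t)) * \1_[set (0 : R)] t)%:E)); last first.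
    apply/funext => t; congr EFin; rewrite indicE.
    have [t0|t0|->] := ltgtP t 0.
    + by rewrite ppow_lt0// !mul0r.
    + by rewrite (ppow_lt0 q) ?mulr0 ?mul0r// sub0r oppr_lt0.
    + by rewrite mem_set ?mulr1.
  have m1 : measurable [set (0 : R)] by exact: measurable_set1.
  transitivity (\int[mu]_(t in [set (0%R : R)]) (ppow a t * ppow q (0 - t)%R)%:E)%E.
    rewrite [RHS]integral_mkcond; apply: eq_integral => t _.
    rewrite patchE indicE; case: ifPn => _; by rewrite ?mulr1 ?mulr0.
  exact: integral_set1.
Qed.

End ppow.


Section gamma.
Context {R : realType}.
Local Notation mu := (@lebesgue_measure R).
Implicit Types (a q t u c : R).

Let h a t : R := ppow a t * expR (- t).

Let h_ge0 a t : 0 <= h a t.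
Proof. by rewrite mulr_ge0 ?ppow_ge0 ?expR_ge0. Qed.

Let mh a : measurable_fun setT (h a).
Proof.
apply: measurable_funM; first exact: measurable_ppow.
apply: measurableT_comp; first exact: measurable_expR.
exact: measurable_funN.
Qed.

(** With [x = t / (2 * p)], this is [ln x <= x - 1 <= x] multiplied by [p] and exponentiated. The
    rate 1/2 leaves half of the decay of [expR (- t)] for integrability. *)
Let powR_le_expR p t : 0 <= p -> 0 <= t -> t `^ p <= (2 * p) `^ p * expR (t / 2).
Proof.
rewrite le_eqVlt => /predU1P[<- t0|p0].
  by rewrite !powRr0 mul1r -expR0 ler_expR divr_ge0.
rewrite le_eqVlt => /predU1P[<-|t0].
  by rewrite powR0 ?gt_eqF// mulr_ge0 ?powR_ge0 ?expR_ge0.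
have p20 : 0 < 2 * p by rewrite mulr_gt0.
have {1}-> : t = 2 * p * (t / (2 * p)) by field; rewrite gt_eqF.
rewrite powRM ?divr_ge0 ?(ltW p20) ?(ltW t0)// ler_wpM2l ?powR_ge0//.
rewrite /powR gt_eqF ?divr_gt0// ler_expR.
have -> : t / 2 = p * (t / (2 * p)) by field; rewrite gt_eqF.
rewrite ler_wpM2l ?(ltW p0)//.
have := le_ln1Dx (_ : -1 < t / (2 * p) - 1).
rewrite (_ : 1 + (_ - 1) = t / (2 * p)); last by ring.
move=> /(_ _)/le_trans; apply; first by rewrite ltrDr divr_gt0.
by rewrite lerBlDr lerDl.
Qed.

Lemma gamma_int_lty a : 1 <= a -> (\int[mu]_t (ppow a t * expR (- t))%:E < +oo)%E.
Proof.
move=> a1; have p0 : 0 <= a - 1 by rewrite subr_ge0.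
set C := (2 * (a - 1)) `^ (a - 1).
have C0 : 0 <= C by exact: powR_ge0.
(* The majorant is a multiple of the exponential density of rate 1/2, whose mass is 1; the factor 2
   cancels the rate in front of that density. *)
apply: (@le_lt_trans _ _ (\int[mu]_t ((2 * C)%:E * (exponential_pdf (2^-1 : R) t)%:E))%E).
  apply: ge0_le_integral => //.
  - by move=> t _; rewrite lee_fin h_ge0.
  - by apply/measurable_EFinP; exact: mh.
  - apply/measurable_EFinP/measurable_funM => //.
    by apply: measurable_exponential_pdf.
  - move=> t _; rewrite -EFinM lee_fin.
    have [t0|t0] := leP 0 t; last first.
      by rewrite ppow_lt0// mul0r !mulr_ge0// exponential_pdf_ge0.
    rewrite ppowE// exponential_pdfE//=.
    rewrite (_ : 2 * C * _ = C * expR (- 2^-1 * t)); last by field.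
    apply: (@le_trans _ _ (C * expR (t / 2) * expR (- t))).
      by rewrite ler_wpM2r ?expR_ge0// powR_le_expR.
    by rewrite -mulrA -expRD ler_wpM2l// ler_expR; lra.
rewrite ge0_integralZl//.
- by rewrite integral_exponential_pdf ?invr_gt0// mule1 ltry.
- by apply/measurable_EFinP; exact: measurable_exponential_pdf.
- by move=> t _; rewrite lee_fin exponential_pdf_ge0.
- by rewrite lee_fin mulr_ge0.
Qed.

Lemma gamma_int_gt0 a : 1 <= a -> (0 < \int[mu]_t (ppow a t * expR (- t))%:E)%E.
Proof.
move=> a1.
(* On [1, 2] the power is at least 1 and the exponential at least [expR (- 2)]. *)
apply: (@lt_le_trans _ _ (\int[mu]_t ((expR (- 2))%:E *
  (\1_(`[1, 2]%classic : set R) t)%:E))%E); last first.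
  apply: ge0_le_integral => //.
  - apply/measurable_EFinP/measurable_funM => //.
  - by apply/measurable_EFinP; exact: mh.
  - move=> t _; rewrite -EFinM lee_fin indicE.
    have [|_] := boolP (t \in _); last by rewrite mulr0 h_ge0.
    rewrite inE/= in_itv/= => /andP[t1 t2]; rewrite mulr1 -[leLHS]mul1r.
    rewrite ler_pM ?expR_ge0 ?ler_expR ?lerN2//.
    rewrite ppowE; last by rewrite (le_trans ler01).
    apply: (@le_trans _ _ (1 `^ (a - 1))); first by rewrite powR1.
    rewrite ge0_ler_powR ?nnegrE ?subr_ge0// (le_trans ler01)//.
rewrite ge0_integralZl//.
- rewrite integral_indic// setIT/= lebesgue_measure_itv/= lte_fin ltr1n -EFinB.
  by rewrite -EFinM lte_fin mulr_gt0 ?expR_gt0// subr_gt0 ltr1n.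
- exact/measurable_EFinP.
Qed.

(** Adding the endpoint 0 does not change the integral, and finiteness ensures that the real-valued
    integral in [Gamma] is not the default value of [fine]. *)
Lemma EFin_Gamma a : 1 <= a ->
  (Gamma a)%:E = (\int[mu]_t (ppow a t * expR (- t))%:E)%E.
Proof.
move=> a1.
rewrite /Gamma /Rintegral.
rewrite (_ : (\int[mu]_(t in `]0%R, +oo[%classic) (t `^ (a - 1) * expR (- t))%:E)%E =
    (\int[mu]_t (ppow a t * expR (- t))%:E)%E); last first.
  rewrite integral_itv_obnd_cbnd; last first.
    apply/measurable_EFinP/measurable_funTS/measurable_funM; first exact: measurable_powR.
    apply: measurableT_comp; first exact: measurable_expR.
    exact: measurable_funN.
  rewrite integral_mkcond; apply: eq_integral => t _; rewrite patchE /ppow indicE.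
  by case: ifPn => _; rewrite ?mul1r ?mul0r.
rewrite fineK// ge0_fin_numE ?gamma_int_lty//.
by apply: integral_ge0 => t _; rewrite lee_fin h_ge0.
Qed.

Lemma Gamma_gt0 a : 1 <= a -> 0 < Gamma a.
Proof. by move=> a1; rewrite -lte_fin EFin_Gamma// gamma_int_gt0. Qed.

(** The product of the two Gamma integrals is the total mass of a convolution. Exchanging the
    integrals by Tonelli leaves, for each [u], the convolution of powers computed in
    [ppow_convolution], times [expR (- u)]. *)
Lemma beta_int_Gamma a q : 1 <= a -> 1 <= q ->
  beta_int a q = (Gamma a * Gamma q / Gamma (a + q))%:E.
Proof.
move=> a1 q1.
have aq1 : 1 <= a + q by lra.
have b0 : (0 <= beta_int a q)%E.
  by apply: integral_ge0 => t _; rewrite lee_fin mulr_ge0 ?ppow_ge0.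
suff E : ((Gamma a)%:E * (Gamma q)%:E = beta_int a q * (Gamma (a + q))%:E)%E.
  rewrite !EFinM E -muleA -EFinM mulfV ?mule1//.
  by rewrite gt_eqF// Gamma_gt0.
have mhh (x : R) : measurable_fun setT (fun u => (h q (u - x))%:E).
  apply/measurable_EFinP; apply: (measurableT_comp (mh q)).
  exact: measurable_funB.
transitivity (\int[mu]_x \int[mu]_u (h a x * h q (u - x))%:E)%E.
  rewrite EFin_Gamma// -ge0_integralZr//; last 3 first.
  - by apply/measurable_EFinP; exact: mh.
  - by move=> t _; rewrite lee_fin h_ge0.
  - by rewrite lee_fin ltW// Gamma_gt0.
  apply: eq_integral => x _; under [RHS]eq_integral do rewrite EFinM.
  rewrite ge0_integralZl//; last 3 first.
  - exact: mhh.
  - by move=> t _; rewrite lee_fin h_ge0.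
  - by rewrite lee_fin h_ge0.
  congr (_ * _)%E; rewrite EFin_Gamma//.
  rewrite (@ge0_integral_affine _ 1 (- x))//; last 2 first.
  - by apply/measurable_EFinP; exact: mh.
  - by move=> t; rewrite lee_fin h_ge0.
  by rewrite mul1e; apply: eq_integral => t _; rewrite mul1r.
pose F (p : measurableTypeR R * measurableTypeR R) := (h a p.1 * h q (p.2 - p.1))%:E.
have mF : measurable_fun setT F.
  apply/measurable_EFinP/measurable_funM.
    exact: (measurableT_comp (mh a)).
  apply: (measurableT_comp (mh q)); exact: measurable_funB.
have F0 p : (0 <= F p)%E by rewrite lee_fin mulr_ge0 ?h_ge0.
rewrite (fubini_tonelli (m1 := mu) (m2 := mu) F mF F0).
transitivity (\int[mu]_u (beta_int a q * (h (a + q) u)%:E))%E; last first.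
  rewrite ge0_integralZl//.
  - by rewrite EFin_Gamma.
  - by apply/measurable_EFinP; exact: mh.
  - by move=> t _; rewrite lee_fin h_ge0.
apply: eq_integral => u _.
rewrite /h EFinM muleA -ppow_convolution// -ge0_integralZr//.
- apply: eq_integral => t _; rewrite -EFinM; congr EFin.
  rewrite /F /h/= mulrACA -expRD; congr (_ * expR _). by rewrite opprB addKr.
- apply/measurable_EFinP/measurable_funM; first exact: measurable_ppow.
  apply: (measurableT_comp (measurable_ppow q)); exact: measurable_funB.
- by move=> t _; rewrite lee_fin mulr_ge0 ?ppow_ge0.
Qed.

Lemma Gamma1 : Gamma 1 = 1 :> R.
Proof.
apply: EFin_inj; rewrite EFin_Gamma// -(@integral_exponential_pdf _ (1 : R))//.
apply: eq_integral => t _; congr EFin; have [t0|t0] := leP 0 t.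
  by rewrite ppowE// subrr powRr0 exponential_pdfE// mulN1r.
by rewrite ppow_lt0// mul0r lt0_exponential_pdf.
Qed.

Lemma integral_powR a : 1 <= a ->
  (\int[mu]_(t in `[0%R, 1%R]) (t `^ (a - 1))%:E = (a^-1)%:E)%E.
Proof.
move=> a1; have a0 : 0 < a by lra.
have cpow p : 0 < p -> {in `]0, +oo[%R, continuous (fun t : R => t `^ p)}.
  move=> p0 t t0; apply: differentiable_continuous; apply/derivable1_diffP.
  exact: derivable_powR.
rewrite (@continuous_FTC2 _ _ (fun t => a^-1 * t `^ a) 0 1)//.
- by rewrite powR1 mulr1 powR0 ?gt_eqF// mulr0 sube0.
(* For [a = 1] the integrand is the constant 1, including at 0; for [a > 1] the exponent is positive
   and the power tends to 0 at 0. *)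
- move: a1; rewrite le_eqVlt => /predU1P[<-|a1].
    rewrite subrr (_ : (fun t : R => t `^ 0) = cst 1).
      by apply: continuous_subspaceT => t; exact: cst_continuous.
    by apply/funext => t; rewrite powRr0.
  apply/continuous_within_itvP => //; split.
  + move=> t; rewrite in_itv/= => /andP[t0 _]; apply: cpow; rewrite ?subr_gt0//.
    by rewrite in_itv/= t0.
  + by rewrite powR0 ?gt_eqF ?subr_gt0//; apply: powR_cvg0; rewrite subr_gt0.
  + apply: cvg_at_left_filter; apply: cpow; rewrite ?subr_gt0//.
    by rewrite in_itv/= ltr01.
- split.
  + move=> t; rewrite in_itv/= => /andP[t0 _]; apply: derivableM => //.
    by apply: derivable_powR; rewrite in_itv/= t0.
  + rewrite powR0 ?gt_eqF//; apply: cvgM; first exact: cvg_cst.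
    exact: powR_cvg0.
  + apply: cvgM; first exact: cvg_cst.
    by apply: cvg_at_left_filter; apply: cpow; rewrite ?in_itv/= ?ltr01.
- move=> t; rewrite in_itv/= => /andP[t0 _].
  have tt : t \in `]0, +oo[%R by rewrite in_itv/= t0.
  rewrite derive1Ml; last exact: derivable_powR.
  by rewrite powR_derive1// mulrA mulVf ?mul1r// gt_eqF.
Qed.

(** The Beta integral at [(a, 1)] is computed twice: directly it is [a^-1], and through
    [beta_int_Gamma] it is [Gamma a / Gamma (a + 1)]. *)
Lemma GammaS a : 1 <= a -> Gamma (a + 1) = a * Gamma a.
Proof.
move=> a1; have a0 : 0 < a by lra.
have a11 : 1 <= a + 1 by lra.
have : beta_int a 1 = (a^-1)%:E.
  rewrite -integral_powR// [RHS]integral_mkcond; apply: eq_integral => t _.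
  rewrite patchE; case: ifPn => [|/negP]; rewrite inE/= in_itv/=.
    by move=> /andP[t0 t1]; rewrite !ppowE ?subr_ge0// subrr powRr0 mulr1.
  move=> /negP; rewrite negb_and -!ltNge => /orP[t0|t1].
    by rewrite ppow_lt0 ?mul0r.
  by rewrite (ppow_lt0 1) ?mulr0// subr_lt0.
rewrite beta_int_Gamma// Gamma1 mulr1 => -[E].
have G0 : Gamma (a + 1) != 0 by rewrite gt_eqF// Gamma_gt0.
move/eqP: E; rewrite -[a^-1]mul1r eqr_div ?G0 ?(lt0r_neq0 a0)// mul1r => /eqP <-.
by rewrite mulrC.
Qed.

End gamma.

(** * The Dirichlet integral *)

Section integral_rVS.
Context {R : realType} {d : nat}.
Local Notation mu := (@lebesgue_measure R).

Let cons (p : measurableTypeR R * 'rV[R]_d) : 'rV[R]_d.+1 :=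
  row_mx (p.1%:M : 'rV_1) p.2.

Let measurable_cons : measurable_fun setT cons.
Proof.
apply: measurable_fun_rVP => i.
case: (unliftP ord0 i) => [j|] ->.
  under eq_fun do rewrite row_mx_rVS.
  by apply: (measurableT_comp (@measurable_rV_coord _ R d j)).
under eq_fun do rewrite row_mx_rV0.
exact: measurable_fst.
Qed.

(** The measure in dimension [d.+1] is the image under [cons] of the product of Lebesgue measure and
    [lebesgue_rV] in dimension [d], so Tonelli applies. *)
Lemma ge0_integral_rVS (F : 'rV[R]_d.+1 -> \bar R) : measurable_fun setT F ->
  (forall v, (0 <= F v)%E) ->
  (\int[@lebesgue_rV R d.+1]_v F v =
   \int[mu]_t \int[@lebesgue_rV R d]_w F (row_mx (t%:M : 'rV_1) w))%E.
Proof.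
move=> mF F0.
rewrite -(fubini_tonelli1 (m1 := mu) (m2 := @lebesgue_rV R d) (F \o cons))//=; last first.
  exact: measurableT_comp.
rewrite -(@ge0_integral_pushforward _ _ _ _ _ cons measurable_cons _ setT F)//.
apply: (congr1 (fun m : set 'rV[R]_d.+1 -> \bar R => integral m setT F)); apply/funext => A.
rewrite /pushforward /product_measure1 /=.
apply: eq_integral => t _ /=; congr (lebesgue_rV _).
by apply/seteqP; split => v; rewrite /xsection /= in_setE.
Qed.

End integral_rVS.

Section dirichlet_integral.
Context {R : realType}.
Local Notation mu := (@lebesgue_measure R).

Definition dsum d (v : 'rV[R]_d) : R := \sum_(j < d) v ord0 j.

(** The unnormalised Dirichlet density on the simplex of size [c]. The size is a parameter because
    fixing a first coordinate [t] leaves a simplex of size [c - t]. *)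
Definition dir_mon d (alpha : 'rV[R]_d) (beta c : R) (v : 'rV[R]_d) : R :=
  \prod_(j < d) ppow (alpha ord0 j) (v ord0 j) * ppow beta (c - dsum v).

Lemma dir_mon_ge0 d (alpha : 'rV[R]_d) beta c v : 0 <= dir_mon alpha beta c v.
Proof. by rewrite mulr_ge0 ?ppow_ge0// prodr_ge0// => j _; exact: ppow_ge0. Qed.

Lemma measurable_dsum d : measurable_fun setT (@dsum d).
Proof. by apply: measurable_sum => j; exact: measurable_rV_coord. Qed.

Lemma measurable_dir_mon d (alpha : 'rV[R]_d) beta c :
  measurable_fun setT (dir_mon alpha beta c).
Proof.
apply: measurable_funM.
  apply: measurable_prod => j _.
  apply: (measurableT_comp (measurable_ppow _)); exact: measurable_rV_coord.
apply: (measurableT_comp (measurable_ppow _)).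
by apply: measurable_funB => //; exact: measurable_dsum.
Qed.

(** Induction on [d]: the inner integral over the last coordinates is a power of [c - t], and
    integrating it against the power of the first coordinate [t] is a convolution of powers. *)
Lemma integral_dir_mon d (alpha : 'rV[R]_d) beta c :
  (forall j, 1 <= alpha ord0 j) -> 1 <= beta ->
  (\int[@lebesgue_rV R d]_v (dir_mon alpha beta c v)%:E =
   ((\prod_(j < d) Gamma (alpha ord0 j)) * Gamma beta /
     Gamma (dsum alpha + beta) * ppow (dsum alpha + beta) c)%:E)%E.
Proof.
move=> + b1; elim: d alpha c => [|d ih] alpha c a1.
  have G0 : Gamma beta != 0 by rewrite gt_eqF// Gamma_gt0.
  rewrite integral_dirac//; last by apply/measurable_EFinP; exact: measurable_dir_mon.
  rewrite diracT mul1e /dir_mon /dsum !big_ord0 !mul1r add0r subr0.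
  by rewrite mulfV// mul1r.
pose alpha' : 'rV[R]_d := \row_j alpha ord0 (lift ord0 j).
have a'1 j : 1 <= alpha' ord0 j by rewrite mxE.
have E : dsum alpha = alpha ord0 ord0 + dsum alpha'.
  rewrite /dsum big_ord_recl; congr (_ + _); apply: eq_bigr => j _.
  by rewrite mxE.
have s0 : 0 <= dsum alpha' by apply: sumr_ge0 => j _; rewrite (le_trans ler01).
have sb1 : 1 <= dsum alpha' + beta by lra.
set C := \prod_(j < d) Gamma (alpha' ord0 j) * Gamma beta / Gamma (dsum alpha' + beta).
have C0 : 0 <= C.
  rewrite divr_ge0 ?mulr_ge0 ?(ltW (Gamma_gt0 _))// prodr_ge0// => j _.
  exact/ltW/Gamma_gt0.
rewrite ge0_integral_rVS; last 2 first.
- by apply/measurable_EFinP; exact: measurable_dir_mon.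
- by move=> v; rewrite lee_fin dir_mon_ge0.
transitivity (\int[mu]_t (C%:E *
  (ppow (alpha ord0 ord0) t * ppow (dsum alpha' + beta) (c - t))%:E))%E.
  apply: eq_integral => t _.
  transitivity (\int[@lebesgue_rV R d]_w
    ((ppow (alpha ord0 ord0) t)%:E * (dir_mon alpha' beta (c - t) w)%:E))%E.
    apply: eq_integral => w _; rewrite -EFinM; congr EFin.
    rewrite /dir_mon /dsum !big_ord_recl !row_mx_rV0 -mulrA; congr (_ * (_ * ppow _ _)).
      by apply: eq_bigr => j _; rewrite row_mx_rVS mxE.
    rewrite opprD addrA; congr (_ - _).
    by apply: eq_bigr => j _; rewrite row_mx_rVS.
  rewrite ge0_integralZl//; last 3 first.
  - by apply/measurable_EFinP; exact: measurable_dir_mon.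
  - by move=> v _; rewrite lee_fin dir_mon_ge0.
  - by rewrite lee_fin ppow_ge0.
  by rewrite ih// -!EFinM; congr EFin; rewrite -/C; ring.
rewrite ge0_integralZl//; last 2 first.
- apply/measurable_EFinP/measurable_funM; first exact: measurable_ppow.
  apply: (measurableT_comp (measurable_ppow _)); exact: measurable_funB.
- by move=> t _; rewrite lee_fin mulr_ge0 ?ppow_ge0.
rewrite ppow_convolution// beta_int_Gamma// -!EFinM; congr EFin.
rewrite E -addrA mulrA; congr (_ * _).
rewrite big_ord_recl (eq_bigr (fun j => Gamma (alpha' ord0 j))); last first.
  by move=> j _; rewrite mxE.
have a01 := a1 ord0.
rewrite /C; field; rewrite !gt_eqF ?Gamma_gt0//; lra.
Qed.

End dirichlet_integral.

(** * Moments of the Dirichlet kernel *)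

Section bounded_on.
Context {R : realType} {T : Type} (P : T -> Prop).
Implicit Types f g : T -> R.

(** Boundedness on a region, stable under ring operations; it yields the uniform constants of the
    remainder estimates without computing them. *)
Definition bdd f := exists C : R, forall x, P x -> `|f x| <= C.

Lemma bdd_cst c : bdd (fun=> c).
Proof. by exists `|c|. Qed.

Lemma bddD f g : bdd f -> bdd g -> bdd (fun x => f x + g x).
Proof.
move=> [A fA] [B gB]; exists (A + B) => x Px.
by rewrite (le_trans (ler_normD _ _))// lerD ?fA ?gB.
Qed.

Lemma bddN f : bdd f -> bdd (fun x => - f x).
Proof. by move=> [A fA]; exists A => x Px; rewrite normrN fA. Qed.

Lemma bddM f g : bdd f -> bdd g -> bdd (fun x => f x * g x).
Proof.
move=> [A fA] [B gB]; exists (A * B) => x Px.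
by rewrite normrM ler_pM ?fA ?gB.
Qed.

Lemma bddX f n : bdd f -> bdd (fun x => f x ^+ n).
Proof.
move=> bf; elim: n => [|n ih]; first exact: (bdd_cst 1).
by under eq_fun do rewrite exprS; exact: bddM.
Qed.

Lemma bddV f : (forall x, P x -> 1 <= f x) -> bdd (fun x => (f x)^-1).
Proof.
move=> f1; exists 1 => x /f1 fx.
rewrite ger0_norm ?invr_ge0 ?(le_trans ler01)// invf_le1//.
exact: lt_le_trans fx.
Qed.

End bounded_on.

Ltac bdd_tac := repeat first [assumption | apply: bddD | apply: bddN | apply: bddM
  | apply: bddX | apply: bdd_cst].

Section dirichlet_moments.
Context {R : realType} {d : nat}.
Local Notation leb := (@lebesgue_rV R d).
Implicit Types (alpha v s : 'rV[R]_d) (beta c : R) (h g : 'rV[R]_d -> R).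

Lemma dsumD_delta alpha (j : 'I_d) : dsum (alpha + delta_mx ord0 j) = dsum alpha + 1.
Proof.
rewrite /dsum (bigD1 j)//= [in RHS](bigD1 j)//= !mxE !eqxx addrAC.
congr (_ + _ + _); apply: eq_bigr => k kj.
by rewrite !mxE eqxx (negbTE kj) addr0.
Qed.

(** The Dirichlet density extended by zero off the simplex, so that all moments are integrals over
    the whole space. *)
Definition dir_density alpha beta v : R :=
  Gamma (dsum alpha + beta) / (Gamma beta * \prod_(j < d) Gamma (alpha ord0 j)) *
  dir_mon alpha beta 1 v.

Lemma measurable_dir_density alpha beta :
  measurable_fun setT (dir_density alpha beta).
Proof. by apply: measurable_funM => //; exact: measurable_dir_mon. Qed.

Section params.
Variables (alpha : 'rV[R]_d) (beta : R).
Hypotheses (a1 : forall j, 1 <= alpha ord0 j) (b1 : 1 <= beta).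

Lemma dsum_beta_ge1 : 1 <= dsum alpha + beta.
Proof.
have s0 : 0 <= dsum alpha by apply: sumr_ge0 => j _; rewrite (le_trans ler01).
by rewrite -[leLHS]add0r lerD.
Qed.

Lemma dir_density_ge0 v : 0 <= dir_density alpha beta v.
Proof.
rewrite mulr_ge0 ?dir_mon_ge0// divr_ge0 ?mulr_ge0 ?(ltW (Gamma_gt0 _))//.
  exact: dsum_beta_ge1.
by apply: prodr_ge0 => j _; exact/ltW/Gamma_gt0.
Qed.

Lemma integral_dir_density : (\int[leb]_v (dir_density alpha beta v)%:E = 1)%E.
Proof.
under eq_integral do rewrite EFinM.
rewrite ge0_integralZl//; last 3 first.
- by apply/measurable_EFinP; exact: measurable_dir_mon.
- by move=> v _; rewrite lee_fin dir_mon_ge0.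
- rewrite lee_fin divr_ge0 ?mulr_ge0 ?(ltW (Gamma_gt0 _))//.
    exact: dsum_beta_ge1.
  by apply: prodr_ge0 => j _; exact/ltW/Gamma_gt0.
rewrite integral_dir_mon// -EFinM; congr EFin.
rewrite ppowE// powR1 mulr1; field.
rewrite !gt_eqF ?Gamma_gt0//; last exact: dsum_beta_ge1.
by rewrite prodr_gt0// => j _; exact: Gamma_gt0.
Qed.

(** The factor [v ord0 j] raises one exponent by one, and [GammaS], applied to [alpha ord0 j] and to
    [dsum alpha + beta], accounts for the change of normalisation. *)
Lemma dir_density_mul (j : 'I_d) v :
  v ord0 j * dir_density alpha beta v =
  alpha ord0 j / (dsum alpha + beta) *
  dir_density (alpha + delta_mx ord0 j) beta v.
Proof.
have [G1 G2 G3] : [/\ Gamma (alpha ord0 j) != 0, Gamma beta != 0 & alpha ord0 j != 0].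
  by rewrite !gt_eqF ?Gamma_gt0// (lt_le_trans ltr01).
have ab1 := dsum_beta_ge1.
have ajE : (alpha + delta_mx ord0 j) ord0 j = alpha ord0 j + 1.
  by rewrite !mxE !eqxx.
have akE (k : 'I_d) : k != j -> (alpha + delta_mx ord0 j) ord0 k = alpha ord0 k.
  by move=> kj; rewrite !mxE eqxx (negbTE kj) addr0.
rewrite /dir_density /dir_mon dsumD_delta.
rewrite (bigD1 j)//= [in X in v ord0 j * (_ * X)](bigD1 j)//=.
rewrite [in RHS](bigD1 j)//= [X in _ = _ * (_ * (X * _))](bigD1 j)//= ajE.
rewrite [X in _ = _ * (_ / (_ * (_ * X)) * _)]
  (eq_bigr (fun k => Gamma (alpha ord0 k))); last by move=> k /akE ->.
rewrite [X in _ = _ * (_ * (_ * X * _))]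
  (eq_bigr (fun k => ppow (alpha ord0 k) (v ord0 k))); last by move=> k /akE ->.
rewrite -ppow_mul// addrAC !GammaS//.
set P := \prod_(i < d | i != j) Gamma _.
have P0 : P != 0.
  by rewrite gt_eqF// prodr_gt0// => k _; exact: Gamma_gt0.
set A := dsum alpha + beta in ab1 *.
have A0 : A != 0 by rewrite gt_eqF// (lt_le_trans ltr01).
by field; rewrite P0 A0 G1 G2 G3.
Qed.

End params.

(** Integrability is bundled with the value, so that linear combinations of moments and comparisons
    between them carry no side conditions. *)
Definition has_moment alpha beta h c : Prop :=
  leb.-integrable setT (fun v => (h v * dir_density alpha beta v)%:E) /\
  (\int[leb]_v (h v * dir_density alpha beta v)%:E = c%:E)%E.

Lemma has_moment1 alpha beta : (forall j, 1 <= alpha ord0 j) -> 1 <= beta ->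
  has_moment alpha beta (fun=> 1) 1.
Proof.
move=> a1 b1.
have E : (fun v => (1 * dir_density alpha beta v)%:E) = EFin \o dir_density alpha beta.
  by apply/funext => v; rewrite mul1r.
rewrite /has_moment E integral_dir_density//; split => //.
apply/integrableP; split.
  by apply/measurable_EFinP; exact: measurable_dir_density.
under eq_integral do rewrite /= ger0_norm ?dir_density_ge0//.
by rewrite integral_dir_density// ltry.
Qed.

Lemma has_momentZ alpha beta h c r : has_moment alpha beta h c ->
  has_moment alpha beta (fun v => r * h v) (r * c).
Proof.
move=> [ih hc].
have E : (fun v => (r * h v * dir_density alpha beta v)%:E) =
    (fun v => r%:E * (h v * dir_density alpha beta v)%:E)%E.
  by apply/funext => v; rewrite -mulrA EFinM.
rewrite /has_moment E; split; first exact: integrableZl.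
by rewrite integralZl// hc.
Qed.

Lemma has_momentD alpha beta h g c e :
  has_moment alpha beta h c -> has_moment alpha beta g e ->
  has_moment alpha beta (fun v => h v + g v) (c + e).
Proof.
move=> [ih hc] [ig ge].
have E : (fun v => ((h v + g v) * dir_density alpha beta v)%:E) =
    ((fun v => (h v * dir_density alpha beta v)%:E) \+
     (fun v => (g v * dir_density alpha beta v)%:E))%E.
  by apply/funext => v; rewrite mulrDl EFinD.
rewrite /has_moment E; split; first exact: integrableD.
by rewrite integralD// hc ge.
Qed.

Lemma has_moment_sum alpha beta (I : Type) (r : seq I) (P : pred I)
    (h : I -> 'rV[R]_d -> R) (c : I -> R) :
  (forall i, P i -> has_moment alpha beta (h i) (c i)) ->
  has_moment alpha beta (fun v => \sum_(i <- r | P i) h i v) (\sum_(i <- r | P i) c i).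
Proof.
move=> hc; elim: r => [|i r ih].
  under eq_fun do rewrite big_nil; rewrite big_nil.
  split; under eq_fun do rewrite mul0r; first exact: integrable0.
  by rewrite integral0.
under eq_fun do rewrite big_cons; rewrite big_cons.
by case: ifPn => // Pi; apply: has_momentD => //; exact: hc.
Qed.

Lemma has_moment_mul alpha beta (j : 'I_d) h c :
  (forall j, 1 <= alpha ord0 j) -> 1 <= beta ->
  has_moment (alpha + delta_mx ord0 j) beta h c ->
  has_moment alpha beta (fun v => v ord0 j * h v)
    (alpha ord0 j / (dsum alpha + beta) * c).
Proof.
move=> a1 b1 [ih hc].
have E : (fun v => (v ord0 j * h v * dir_density alpha beta v)%:E) =
    (fun v => (alpha ord0 j / (dsum alpha + beta))%:E *
      (h v * dir_density (alpha + delta_mx ord0 j) beta v)%:E)%E.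
  apply/funext => v; rewrite -EFinM; congr EFin.
  by rewrite mulrAC dir_density_mul// mulrAC -!mulrA.
rewrite /has_moment E; split; first exact: integrableZl.
by rewrite integralZl// hc.
Qed.

Lemma has_momentE alpha beta h c g e : has_moment alpha beta h c ->
  h =1 g -> c = e -> has_moment alpha beta g e.
Proof. by move=> + /funext <- <-. Qed.

End dirichlet_moments.

(** * Expansions of the central moments in the bandwidth, with uniform remainders *)

Section central_moment_bounds.
Context {R : realType}.

(** The left-hand side is exactly [b ^+ 2] times the function bounded in [CP], whose denominator is
    at least 1. In use, [D] is [d.+1]. *)
Lemma mean_remainder (D : R) : 0 <= D -> exists C, forall b s : R,
  0 < b <= 1 -> 0 <= s <= 1 ->
  `|(s + b) / (1 + b * D) - s - b * (1 - D * s)| <= C * b ^+ 2.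
Proof.
move=> D0.
pose P (x : R * R) := (0 < x.1 <= 1) /\ (0 <= x.2 <= 1).
have bb : bdd P (fun x => x.1).
  by exists 1 => x [/andP[x0 x1] _]; rewrite ger0_norm// ltW.
have bs : bdd P (fun x => x.2).
  by exists 1 => x [_ /andP[x0 x1]]; rewrite ger0_norm.
have bV : bdd P (fun x => (1 + x.1 * D)^-1).
  by apply: bddV => x [/andP[x0 _] _]; rewrite lerDl mulr_ge0// ltW.
have [C CP] : bdd P (fun x => - D * (1 - D * x.2) * (1 + x.1 * D)^-1) by bdd_tac.
exists C => b s b01 s01; have := CP (b, s) (conj b01 s01) => /=.
have bD : 1 + b * D != 0.
  by rewrite gt_eqF// ltr_pwDl// mulr_ge0// ltW//; case/andP: b01.
move=> h; rewrite -ler_pdivrMr ?exprn_gt0//; last by case/andP: b01.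
move: b01 => /andP[b0 _].
rewrite -[X in _ * X <= _]gtr0_norm ?invr_gt0 ?exprn_gt0// -normrM.
apply: le_trans h; rewrite le_eqVlt; apply/orP; left; apply/eqP; congr (`|_|).
by field; rewrite bD gt_eqF.
Qed.

(** Same method: [b ^+ 2] factors out exactly. Here [s] and [t] stand for two coordinates of the
    centre and [w] for the indicator that their indices agree. *)
Lemma covariance_remainder (D : R) : 0 <= D -> exists C, forall b s t w : R,
  0 < b <= 1 -> 0 <= s <= 1 -> 0 <= t <= 1 -> 0 <= w <= 1 ->
  `|(s + b) / (1 + b * D) * ((t + b + b * w) / (1 + b * (D + 1)))
    - s * ((t + b) / (1 + b * D)) - t * ((s + b) / (1 + b * D)) + s * t
    - b * (s * (w - t))| <= C * b ^+ 2.
Proof.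
move=> D0.
pose P (x : R * R * R * R) := [/\ 0 < x.1.1.1 <= 1, 0 <= x.1.1.2 <= 1,
  0 <= x.1.2 <= 1 & 0 <= x.2 <= 1].
have bb : bdd P (fun x => x.1.1.1).
  by exists 1 => x [/andP[x0 x1] _ _ _]; rewrite ger0_norm// ltW.
have bs : bdd P (fun x => x.1.1.2).
  by exists 1 => x [_ /andP[x0 x1] _ _]; rewrite ger0_norm.
have bt : bdd P (fun x => x.1.2).
  by exists 1 => x [_ _ /andP[x0 x1] _]; rewrite ger0_norm.
have bw : bdd P (fun x => x.2).
  by exists 1 => x [_ _ _ /andP[x0 x1]]; rewrite ger0_norm.
have bV : bdd P (fun x => (1 + x.1.1.1 * D)^-1).
  by apply: bddV => x [/andP[x0 _] _]; rewrite lerDl mulr_ge0// ltW.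
have bV1 : bdd P (fun x => (1 + x.1.1.1 * (D + 1))^-1).
  by apply: bddV => x [/andP[x0 _] _]; rewrite lerDl mulr_ge0 ?addr_ge0// ltW.
have [C CP] : bdd P (fun x => ((1 + x.2) - (x.1.1.2 + x.1.2) * (D + 1) +
    x.1.1.2 * x.1.2 * D * (D + 1) - x.1.1.2 * (x.2 - x.1.2) * (2 * D + 1) -
    x.1.1.1 * x.1.1.2 * (x.2 - x.1.2) * D * (D + 1)) *
    (1 + x.1.1.1 * D)^-1 * (1 + x.1.1.1 * (D + 1))^-1) by bdd_tac.
exists C => b s t w b01 s01 t01 w01.
have := CP (b, s, t, w) (And4 b01 s01 t01 w01) => /= h.
have bD : 1 + b * D != 0.
  by rewrite gt_eqF// ltr_pwDl// mulr_ge0// ltW//; case/andP: b01.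
have bD1 : 1 + b * (D + 1) != 0.
  by rewrite gt_eqF// ltr_pwDl// mulr_ge0 ?addr_ge0// ltW//; case/andP: b01.
rewrite -ler_pdivrMr ?exprn_gt0//; last by case/andP: b01.
move: b01 => /andP[b0 _].
rewrite -[X in _ * X <= _]gtr0_norm ?invr_gt0 ?exprn_gt0// -normrM.
apply: le_trans h; rewrite le_eqVlt; apply/orP; left; apply/eqP; congr (`|_|).
by field; rewrite bD bD1 gt_eqF.
Qed.

(** [m n] is the raw moment of order [n] of one coordinate, and the bounded expression is the
    binomial expansion of the fourth moment about [s]. *)
Lemma fourth_moment_bound (D : R) : 0 <= D -> exists C, forall b s : R,
  0 < b <= 1 -> 0 <= s <= 1 ->
  let m n := \prod_(i < n) ((s + b * (1 + i%:R)) / (1 + b * (D + i%:R))) in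
  `|m 4 - 4 * s * m 3 + 6 * s ^+ 2 * m 2 - 4 * s ^+ 3 * m 1%N + s ^+ 4| <= C * b ^+ 2.
Proof.
move=> D0.
pose P (x : R * R) := (0 < x.1 <= 1) /\ (0 <= x.2 <= 1).
have bb : bdd P (fun x => x.1).
  by exists 1 => x [/andP[x0 x1] _]; rewrite ger0_norm// ltW.
have bs : bdd P (fun x => x.2).
  by exists 1 => x [_ /andP[x0 x1]]; rewrite ger0_norm.
have D1 i : 0 <= D + i%:R by rewrite addr_ge0.
have bV i : bdd P (fun x => (1 + x.1 * (D + i%:R))^-1).
  by apply: bddV => x [/andP[x0 _] _]; rewrite lerDl mulr_ge0// ltW.
(* [b ^+ 2 * Q b s] is the numerator of the left-hand side over the common
   denominator: its terms of order 0 and 1 in [b] cancel. *)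
pose Q (b s : R) : R := 
  24 * b ^+ 2 + 26 * s * b - 72 * s * b ^+ 2 - 24 * s * b ^+ 2 * D
  + 3 * s ^+ 2 - 72 * s ^+ 2 * b - 20 * s ^+ 2 * b * D
  + 72 * s ^+ 2 * b ^+ 2 + 60 * s ^+ 2 * b ^+ 2 * D
  + 12 * s ^+ 2 * b ^+ 2 * D ^+ 2 - 6 * s ^+ 3 + 64 * s ^+ 3 * b
  + 42 * s ^+ 3 * b * D + 6 * s ^+ 3 * b * D ^+ 2
  - 24 * s ^+ 3 * b ^+ 2 - 44 * s ^+ 3 * b ^+ 2 * D
  - 24 * s ^+ 3 * b ^+ 2 * D ^+ 2 - 4 * s ^+ 3 * b ^+ 2 * D ^+ 3
  + 3 * s ^+ 4 - 18 * s ^+ 4 * b - 22 * s ^+ 4 * b * D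
  - 6 * s ^+ 4 * b * D ^+ 2 + 6 * s ^+ 4 * b ^+ 2 * D
  + 11 * s ^+ 4 * b ^+ 2 * D ^+ 2 + 6 * s ^+ 4 * b ^+ 2 * D ^+ 3
  + s ^+ 4 * b ^+ 2 * D ^+ 4.
have [C CP] : bdd P (fun x => Q x.1 x.2 * ((1 + x.1 * (D + 0%:R))^-1 *
    (1 + x.1 * (D + 1%:R))^-1 * (1 + x.1 * (D + 2%:R))^-1 * (1 + x.1 * (D + 3%:R))^-1)).
  by rewrite /Q; bdd_tac; apply: bV.
exists C => b s b01 s01; cbv zeta; have := CP (b, s) (conj b01 s01); rewrite [_.1]/= [_.2]/=.
have bD i : 1 + b * (D + i%:R) != 0.
  by rewrite gt_eqF// ltr_pwDl// mulr_ge0// ltW//; case/andP: b01.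
move: (bD 0) (bD 1%N) (bD 2%N) (bD 3%N) => b0 b1 b2 b3 {bD}.
move=> h; rewrite -ler_pdivrMr ?exprn_gt0//; last by case/andP: b01.
move: b01 => /andP[bgt0 _].
rewrite -[X in _ * X <= _]gtr0_norm ?invr_gt0 ?exprn_gt0// -normrM.
apply: le_trans h; rewrite le_eqVlt; apply/orP; left; apply/eqP; congr (`|_|).
rewrite /Q !big_ord_recr !big_ord0 /= !mul1r.
field.
by rewrite b1 b2 b3 (_ : 1 + b * D != 0) ?(gt_eqF bgt0)//; rewrite addr0 in b0.
Qed.

End central_moment_bounds.

(** * Moments of the kernel at a given point of the simplex *)

Section kernel_moments.
Context {R : realType} {d : nat}.
Local Notation leb := (@lebesgue_rV R d).
Implicit Types (alpha v s : 'rV[R]_d) (beta c b : R) (j k : 'I_d).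

Lemma addr_delta_ge1 alpha j : (forall k, 1 <= alpha ord0 k) ->
  forall k, 1 <= (alpha + delta_mx ord0 j) ord0 k.
Proof.
by move=> a1 k; rewrite !mxE eqxx/= (le_trans (a1 k))// lerDl ler0n.
Qed.

(** Induction on [n] for all [alpha] at once, since extracting one factor [v ord0 j] replaces
    [alpha] by [alpha + delta_mx ord0 j]. *)
Lemma has_moment_pow alpha beta j n : (forall k, 1 <= alpha ord0 k) -> 1 <= beta ->
  has_moment alpha beta (fun v => v ord0 j ^+ n)
   (\prod_(i < n) ((alpha ord0 j + i%:R) / (dsum alpha + beta + i%:R))).
Proof.
move=> a1 b1; elim: n alpha a1 => [|n ih] alpha a1.
  by rewrite big_ord0; exact: has_moment1.
have := has_moment_mul a1 b1 (ih _ (addr_delta_ge1 j a1)).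
move=> /has_momentE; apply; first by move=> v; rewrite exprS.
rewrite big_ord_recl/= !addr0; congr (_ * _); apply: eq_bigr => i _.
rewrite dsumD_delta !mxE !eqxx /bump/= natrD; congr (_ / _); ring.
Qed.

Lemma has_moment_pair alpha beta j k : (forall k, 1 <= alpha ord0 k) -> 1 <= beta ->
  has_moment alpha beta (fun v => v ord0 j * v ord0 k)
   (alpha ord0 j / (dsum alpha + beta) *
     ((alpha ord0 k + (j == k)%:R) / (dsum alpha + beta + 1))).
Proof.
move=> a1 b1.
have a'1 := addr_delta_ge1 j a1.
have := has_moment_mul a1 b1 (@has_moment_pow _ _ k 1 a'1 b1).
move=> /has_momentE; apply; first by move=> v; rewrite expr1.
rewrite big_ord_recl big_ord0 /= !addr0 mulr1 dsumD_delta !mxE eqxx/= [k == j]eq_sym.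
by congr (_ * (_ / _)); ring.
Qed.

Lemma coord_le_dsum v j : (forall k, 0 <= v ord0 k) -> v ord0 j <= dsum v.
Proof. by move=> v0; rewrite /dsum (bigD1 j)//= lerDl sumr_ge0. Qed.

Lemma l1norm_dsum v : (forall k, 0 <= v ord0 k) -> l1norm v = dsum v.
Proof. by move=> v0; apply: eq_bigr => j _; rewrite ger0_norm. Qed.

Lemma simplexP v : simplex v <-> (forall j, 0 <= v ord0 j) /\ dsum v <= 1.
Proof.
split=> [[v01 v1]|[v0 v1]].
  have v0 j : 0 <= v ord0 j by case/andP: (v01 j).
  by split => //; rewrite -l1norm_dsum.
split=> [j|]; last by rewrite l1norm_dsum.
by rewrite v0/= (le_trans (coord_le_dsum j v0)).
Qed.

Lemma simplex_l1norm s : simplex s -> l1norm s = dsum s.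
Proof. by move=> /simplexP[s0 _]; exact: l1norm_dsum. Qed.

Definition kdens s b := dir_density (b^-1 *: s + const_mx 1) ((1 - dsum s) / b + 1).

Section fixed_center.
Variables (s : 'rV[R]_d) (b : R).
Hypotheses (Ss : simplex s) (b0 : 0 < b).
Let alpha := b^-1 *: s + const_mx 1.
Let beta := (1 - dsum s) / b + 1.
Local Notation D := (d.+1%:R : R).

Let alphaE j : alpha ord0 j = s ord0 j / b + 1.
Proof. by rewrite !mxE mulrC. Qed.

Let alpha1 j : 1 <= alpha ord0 j.
Proof.
rewrite alphaE lerDr divr_ge0// ?(ltW b0)//.
by case: Ss => /(_ j)/andP[].
Qed.

Let beta1 : 1 <= beta.
Proof.
by rewrite /beta lerDr divr_ge0 ?(ltW b0)// subr_ge0 -simplex_l1norm//; case: Ss.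
Qed.

(** The terms in [s] cancel, so the total parameter mass depends on the bandwidth and the dimension
    only. *)
Let dsumE : dsum alpha + beta = b^-1 + D.
Proof.
have -> : dsum alpha = dsum s / b + d%:R.
  rewrite /dsum (eq_bigr (fun j => s ord0 j / b + 1)) => [|j _]; last exact: alphaE.
  by rewrite big_split/= -mulr_suml sumr_const card_ord.
by rewrite /beta -natr1; field; rewrite gt_eqF.
Qed.

Lemma dirichlet_kernelE v : simplex v -> dirichlet_kernel s b v = kdens s b v.
Proof.
move=> Sv; have [v01 v1] := Sv.
have -> : dirichlet_kernel s b = dirichlet_pdf alpha beta.
  by rewrite /dirichlet_kernel simplex_l1norm.
rewrite /dirichlet_pdf /kdens /dir_density -/alpha -/beta.
have -> : l1norm alpha = dsum alpha.
  by apply: eq_bigr => j _; rewrite ger0_norm// (le_trans ler01).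
rewrite -mulrA; congr (_ * _); rewrite /dir_mon mulrC simplex_l1norm//.
rewrite [in RHS]ppowE ?subr_ge0 -?simplex_l1norm//; congr (_ * _).
by apply: eq_bigr => j _; rewrite ppowE//; case/andP: (v01 j).
Qed.

Lemma kdens_out v : ~ simplex v -> kdens s b v = 0.
Proof.
move=> nSv; rewrite /kdens /dir_density /dir_mon.
have [|/existsNP[j /negP]] := pselect (forall j, 0 <= v ord0 j); last first.
  rewrite -ltNge => vj0.
  by rewrite [X in _ * (X * _)](bigD1 j)//= ppow_lt0// !mul0r mulr0.
move=> v0; rewrite (ppow_lt0 _ (t := 1 - dsum v)) ?mulr0//.
by rewrite subr_lt0 ltNge; apply/negP => v1; apply/nSv/simplexP.
Qed.

(** Multiplying numerator and denominator by [b] gives a form that stays regular as [b] tends to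
    0. *)
Lemma ratioE (j : 'I_d) (i : R) : 0 <= i ->
  (alpha ord0 j + i) / (dsum alpha + beta + i) =
  (s ord0 j + b * (1 + i)) / (1 + b * (D + i)).
Proof.
move=> i0; rewrite dsumE alphaE.
have h : 0 < 1 + b * (D + i).
  by rewrite ltr_pwDl// mulr_ge0 ?addr_ge0// ltW.
have h' : 0 < b^-1 + D + i.
  by rewrite -addrA ltr_pwDl ?invr_gt0// addr_ge0.
apply/eqP; rewrite eqr_div ?(gt_eqF h) ?(gt_eqF h')//; apply/eqP; field.
exact: lt0r_neq0.
Qed.

Let m j n := \prod_(i < n) ((s ord0 j + b * (1 + i%:R)) / (1 + b * (D + i%:R))).

Let mom_pow j n : has_moment alpha beta (fun v => v ord0 j ^+ n) (m j n).
Proof.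
apply: (has_momentE (has_moment_pow j n alpha1 beta1)) => //.
by apply: eq_bigr => i _; rewrite ratioE.
Qed.

Let m1E j : m j 1 = (s ord0 j + b) / (1 + b * D).
Proof. by rewrite /m big_ord_recl big_ord0 /= !addr0 !mulr1. Qed.

Lemma kdens_mass : has_moment alpha beta (fun=> 1) 1.
Proof. exact: has_moment1. Qed.

Lemma kdens_mean j : has_moment alpha beta (fun v => v ord0 j - s ord0 j)
  ((s ord0 j + b) / (1 + b * D) - s ord0 j).
Proof.
have := has_momentD (mom_pow j 1) (has_momentZ (- s ord0 j) kdens_mass).
by move=> /has_momentE; apply=> [v|]; rewrite ?expr1 ?m1E mulr1.
Qed.

(** The deviations are taken from [s], not from the mean of the law, as in the Taylor polynomial at
    [s]; the value is left in the form that [covariance_remainder] estimates. *)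
Lemma kdens_covariance j k : has_moment alpha beta
  (fun v => (v ord0 j - s ord0 j) * (v ord0 k - s ord0 k))
  ((s ord0 j + b) / (1 + b * D) *
     ((s ord0 k + b + b * (j == k)%:R) / (1 + b * (D + 1)))
    - s ord0 j * ((s ord0 k + b) / (1 + b * D))
    - s ord0 k * ((s ord0 j + b) / (1 + b * D)) + s ord0 j * s ord0 k).
Proof.
have M2 := has_moment_pair j k alpha1 beta1.
have Mj := has_momentZ (- s ord0 k) (mom_pow j 1).
have Mk := has_momentZ (- s ord0 j) (mom_pow k 1).
have M0 := has_momentZ (s ord0 j * s ord0 k) kdens_mass.
have := has_momentD (has_momentD (has_momentD M2 Mk) Mj) M0.
move=> /has_momentE; apply=> [v|]; first by ring.
rewrite !m1E !mulNr mulr1; congr (_ * _ - _ - _ + _).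
  by have := ratioE j (lexx 0); rewrite !addr0 mulr1.
have h : 0 < 1 + b * (D + 1).
  by rewrite ltr_pwDl// mulr_ge0 ?addr_ge0// ltW.
have h' : 0 < b^-1 + D + 1.
  by rewrite -addrA ltr_pwDl ?invr_gt0// addr_ge0.
rewrite dsumE alphaE.
apply/eqP; rewrite eqr_div ?(gt_eqF h) ?(gt_eqF h')//; apply/eqP; field.
exact: lt0r_neq0.
Qed.

Lemma kdens_fourth j : has_moment alpha beta (fun v => (v ord0 j - s ord0 j) ^+ 4)
  (m j 4 - 4 * s ord0 j * m j 3 + 6 * s ord0 j ^+ 2 * m j 2 - 4 * s ord0 j ^+ 3 * m j 1%N
    + s ord0 j ^+ 4).
Proof.
have M3 := has_momentZ (- (4 * s ord0 j)) (mom_pow j 3).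
have M2 := has_momentZ (6 * s ord0 j ^+ 2) (mom_pow j 2).
have M1 := has_momentZ (- (4 * s ord0 j ^+ 3)) (mom_pow j 1).
have M0 := has_momentZ (s ord0 j ^+ 4) kdens_mass.
have := has_momentD (has_momentD (has_momentD (has_momentD (mom_pow j 4) M3) M2) M1) M0.
by move=> /has_momentE; apply=> [v|]; ring.
Qed.

End fixed_center.

End kernel_moments.

(** * Uniform continuity, line derivatives and one-variable Taylor *)

Section epsilon_delta.
Context {R : realType} {V : normedModType R}.
Implicit Types (K : set V) (H : V -> R).

Lemma near_within_ballP K (x : V) (P : V -> Prop) :
  (\forall y \near within K (nbhs x), P y) <->
  exists2 r : R, 0 < r & forall y, K y -> `|x - y| < r -> P y.
Proof.
split.
  move=> /nbhs_normP[r /= r0 xr]; exists r => // y Ky xy.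
  exact: (xr y xy Ky).
move=> [r r0 xr]; apply/nbhs_normP; exists r => //= y xy Ky.
exact: xr.
Qed.

Lemma within_continuous_epsP K H :
  {within K, continuous H} <-> forall x, K x -> forall e : R, 0 < e ->
    exists2 r : R, 0 < r & forall y, K y -> `|x - y| < r -> `|H x - H y| < e.
Proof.
rewrite subspace_continuousP; split => KH x Kx.
  move=> e e0; apply/near_within_ballP.
  by have /cvgrPdist_lt := KH x Kx; apply.
by apply/cvgrPdist_lt => e e0; apply/near_within_ballP; exact: KH.
Qed.

Lemma compact_uniformly_continuous K H (e : R) : compact K ->
  {within K, continuous H} -> 0 < e ->
  exists2 r : R, 0 < r &
    forall x y, K x -> K y -> `|x - y| < r -> `|H x - H y| < e.
Proof.
move=> cK /within_continuous_epsP cH e0.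
have /compact_near_coveringP ncK := cK.
(* [Q r x] says that [r] is a modulus of continuity at [x]; the near-covering form of compactness
   turns local validity for small [r] into validity on all of [K]. *)
pose Q (r : R) (x : V) := forall y, K x -> K y -> `|x - y| < r -> `|H x - H y| < e.
have : \forall r \near (0 : R)^'+, K `<=` Q r.
  apply: ncK => x Kx.
  have [r r0 xr] := cH x Kx (e / 2) (divr_gt0 e0 (ltr0n _ 2)).
  have r20 : 0 < r / 2 by rewrite divr_gt0.
  (* Two distances below [r / 2] keep both [x'] and [y] within [r] of [x]. *)
  exists (ball x (r / 2), [set u : R | u < r / 2]) => /=.
    split; first exact: nbhsx_ballx.
    exact: nbhs_right_lt.
  move=> [x' u] /= [+ ur] y Kx' Ky x'y; rewrite -ball_normE /= => xx'.
  rewrite (splitr e) -(subrKA (H x)) (le_lt_trans (ler_normD _ _))// ltrD//.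
    by rewrite distrC xr// (lt_trans xx')// ltr_pdivrMr// mulr2n mulrDr mulr1 ltrDr.
  rewrite xr// (splitr r) -(subrKA x') (le_lt_trans (ler_normD _ _))// ltrD//.
  exact: lt_trans ur.
case=> r /= r0 rP; exists (r / 2); first by rewrite divr_gt0.
move=> x y Kx Ky xy.
apply: (rP (r / 2) _ _ x Kx y Kx Ky xy) => /=; last by rewrite divr_gt0.
by rewrite sub0r normrN ger0_norm ?ltr_pdivrMr ?divr_ge0 ?(ltW r0)// mulr2n mulrDr mulr1 ltrDr.
Qed.

Lemma compact_bounded_fun K H : compact K -> {within K, continuous H} ->
  exists2 M : R, 0 <= M & forall x, K x -> `|H x| <= M.
Proof.
move=> cK cH.
have /compact_bounded[M [Mr HM]] := continuous_compact cH cK.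
exists (`|M| + 1); first by rewrite addr_ge0.
move=> x Kx; apply: HM; last by exists x.
by rewrite (le_lt_trans (ler_norm M))// ltrDl.
Qed.

(** The limits at [x] and at a nearby [y] are compared through some [z] in [A], so close to [y] that
    [h z] approximates the limit at [y] while [z] is still within the radius [r] valid at [x]. *)
Lemma within_lim_continuous (A K : set V) (h : V -> R) :
  (forall x, K x -> ProperFilter (within A (nbhs x))) ->
  (forall x, K x -> cvg (h y @[y --> within A (nbhs x)])) ->
  {within K, continuous (fun x => lim (h y @[y --> within A (nbhs x)]))}.
Proof.
move=> pA ch; set H := fun x => _.
have hH x : K x -> h y @[y --> within A (nbhs x)] --> H x by move=> /ch.
apply/within_continuous_epsP => x Kx e e0.
have e20 : 0 < e / 2 by rewrite divr_gt0.
have /cvgrPdist_lt/(_ _ e20)/near_within_ballP[r r0 xr] := hH x Kx.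
exists r => // y Ky xy.
have /cvgrPdist_lt/(_ _ e20)/near_within_ballP[u u0 yu] := hH y Ky.
have [z [Az /= yz]] : exists z, A z /\ `|y - z| < Num.min u (r - `|x - y|).
  have FF := pA y Ky.
  have [] := @filter_ex _ _ FF (fun z => A z /\ `|y - z| < Num.min u (r - `|x - y|)).
    apply/near_within_ballP; exists (Num.min u (r - `|x - y|)) => //.
    by rewrite lt_min u0 subr_gt0.
  by move=> z; exists z.
move: yz; rewrite lt_min => /andP[yzu yzr].
rewrite (splitr e) -(subrKA (h z)) (le_lt_trans (ler_normD _ _))// ltrD//.
  apply: xr => //; rewrite -(subrKA y) (le_lt_trans (ler_normD _ _))//.
  by rewrite -ltrBrDl.
by rewrite distrC yu.
Qed.

(** The filter does not exclude [x] itself, so an existing limit must equal the value at [x]. *)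
Lemma within_lim_self (A : set V) (h : V -> R) (x : V) :
  ProperFilter (within A (nbhs x)) -> A x ->
  cvg (h y @[y --> within A (nbhs x)]) ->
  lim (h y @[y --> within A (nbhs x)]) = h x.
Proof.
move=> pA Ax ch; set l := lim _.
apply/eqP; rewrite -subr_eq0 -normr_le0; apply/ler_addgt0Pl => e e0.
rewrite addr0 ltW//.
have hl : h y @[y --> within A (nbhs x)] --> l by exact: ch.
have /cvgrPdist_lt/(_ _ e0)/near_within_ballP[r r0] := hl.
by apply => //; rewrite subrr normr0.
Qed.

Lemma is_derive_line (h : V -> R) (a v : V) (u : R) :
  differentiable h (a + u *: v) ->
  is_derive u (1 : R) (fun w : R => h (a + w *: v)) ('d h (a + u *: v) v).
Proof.
move=> dh.
have E : (fun k : R => k^-1 *: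
      (((fun w : R => h (a + w *: v)) \o shift u) (k *: 1) - h (a + u *: v))) =
    (fun k : R => k^-1 *: ((h \o shift (a + u *: v)) (k *: v) - h (a + u *: v))).
  apply/funext => k /=; congr (_ *: (h _ - _)).
  by rewrite /shift /= addrCA scalerDl /GRing.scale/= mulr1.
have dv : derivable h (a + u *: v) v by exact: diff_derivable.
apply: DeriveDef.
  by rewrite /derivable E.
by rewrite /derive E -deriveE.
Qed.

End epsilon_delta.

(* Rolle's theorem applied to the function [u |-> phi u + (1 - u) phi' u + (1 - u)^2 K]
   with [K] chosen to equalize the values at 0 and 1. *)
Lemma taylor_order2 {R : realType} (phi psi chi : R -> R) :
  {within `[0, 1], continuous phi} -> {within `[0, 1], continuous psi} ->
  (forall u : R, u \in `]0, 1[%R -> is_derive u 1 phi (psi u)) ->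
  (forall u : R, u \in `]0, 1[%R -> is_derive u 1 psi (chi u)) ->
  exists2 c, c \in `]0, 1[%R & phi 1 = phi 0 + psi 0 + chi c / 2.
Proof.
move=> cphi cpsi dphi dpsi.
pose K := phi 1 - phi 0 - psi 0.
pose F u := phi u + (1 - u) * psi u + (1 - u) ^+ 2 * K.
have dF (u : R) : u \in `]0, 1[%R -> is_derive u 1 F ((1 - u) * (chi u - 2 * K)).
  move=> u01; have d1 := dphi u u01; have d2 := dpsi u u01.
  rewrite /F; apply: is_derive_eq.
  rewrite /GRing.scale/=; ring.
have cF : {within `[0, 1], continuous F}.
  have c1 (u : R) : 1 - w @[w --> within `[0, 1] (nbhs u)] --> 1 - u.
    apply: cvg_within_filter; apply: cvgB; first exact: cvg_cst.
    exact: cvg_id.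
  apply/subspace_continuousP => u u01; apply: cvgD.
    apply: cvgD; first by move/subspace_continuousP: cphi; apply.
    by apply: cvgM => //; move/subspace_continuousP: cpsi; apply.
  apply: cvgM; last exact: cvg_cst.
  exact: cvgM.
have F01 : F 0 = F 1 by rewrite /F /K; ring.
have [|c c01 dc] := Rolle ltr01 _ cF F01.
  by move=> u /dF [].
exists c => //.
have /@derive_val := dF c c01; rewrite (@derive_val _ _ _ _ _ _ _ dc) => /esym/eqP.
rewrite mulf_eq0 subr_eq0 => /orP[|].
  by move: c01; rewrite in_itv/= => /andP[_ c1] /eqP c1'; rewrite c1' ltxx in c1.
rewrite subr_eq0 => /eqP ->; rewrite /K; by field.
Qed.

(** * Taylor expansion up to the boundary of the simplex *)

Section simplex_geometry.
Context {R : realType} {d : nat}.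
Implicit Types (s t v : 'rV[R]_d) (j : 'I_d).

Lemma int_simplexP v : int_simplex v <-> (forall j, 0 < v ord0 j) /\ dsum v < 1.
Proof.
split=> [[v01 v1]|[v0 v1]].
  have v0 j : 0 < v ord0 j by case/andP: (v01 j).
  by split => //; rewrite -l1norm_dsum// => j; exact: ltW.
have v0' j : 0 <= v ord0 j by exact: ltW.
split=> [j|]; last by rewrite l1norm_dsum.
by rewrite v0/= (le_lt_trans (coord_le_dsum j v0')).
Qed.

Lemma sub_int_simplex : int_simplex `<=` @simplex R d.
Proof.
move=> v /int_simplexP[v0 v1]; apply/simplexP; split; last exact: ltW.
by move=> j; exact: ltW.
Qed.

Lemma dsumD s t : dsum (s + t) = dsum s + dsum t.
Proof. by rewrite /dsum -big_split; apply: eq_bigr => j _; rewrite mxE. Qed.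

Lemma dsumZ a s : dsum (a *: s) = a * dsum s.
Proof. by rewrite /dsum mulr_sumr; apply: eq_bigr => j _; rewrite mxE. Qed.

(** The weight [u] of the interior point is positive, which makes every inequality strict. *)
Lemma int_simplex_segment s t (u : R) : simplex s -> int_simplex t ->
  0 < u <= 1 -> int_simplex (s + u *: (t - s)).
Proof.
move=> /simplexP[s0 s1] /int_simplexP[t0 t1] /andP[u0 u1].
have -> : s + u *: (t - s) = (1 - u) *: s + u *: t.
  by rewrite scalerBr scalerBl scale1r addrCA addrC.
have u1' : 0 <= 1 - u by rewrite subr_ge0.
apply/int_simplexP; split=> [j|].
  by rewrite !mxE ltr_wpDl ?mulr_ge0 ?mulr_gt0.
rewrite dsumD !dsumZ; apply: (@lt_le_trans _ _ ((1 - u) * 1 + u * 1)); last by lra.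
by rewrite ler_ltD ?ler_wpM2l ?ltr_pM2l.
Qed.

(** This makes the filters in [simplex_partial] proper at boundary points. Any point of the simplex
    is approached along the segment towards the barycentre [c]. *)
Lemma closure_int_simplex : @simplex R d `<=` closure (@int_simplex R d).
Proof.
move=> s Ss A /nbhs_normP[r /= r0 sA].
pose c : 'rV[R]_d := const_mx d.+1%:R^-1.
have Ic : int_simplex c.
  apply/int_simplexP; split=> [j|]; first by rewrite mxE invr_gt0.
  rewrite /dsum (eq_bigr (fun=> d.+1%:R^-1)) => [|j _]; last by rewrite mxE.
  by rewrite sumr_const card_ord -[_ *+ _]mulr_natl ltr_pdivrMr// mul1r ltr_nat.
have n0 : 0 < `|c - s| + 1 by rewrite ltr_wpDl.
(* The displacement is [u * |c - s|], which is below [r]; the added 1 keeps the denominator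
   positive. *)
pose u := Num.min 1 (r / (`|c - s| + 1)).
have u0 : 0 < u by rewrite lt_min ltr01 divr_gt0.
exists (s + u *: (c - s)); split.
  by apply: int_simplex_segment => //; rewrite u0 ge_min lexx.
apply: sA => /=; rewrite opprD addrA subrr sub0r normrN normrZ (gtr0_norm u0).
apply: (@le_lt_trans _ _ (r / (`|c - s| + 1) * `|c - s|)).
  by rewrite ler_wpM2r// ge_min lexx orbT.
by rewrite mulrAC ltr_pdivrMr// ltr_pM2l// ltrDl.
Qed.

Lemma proper_within_int_simplex s : simplex s ->
  ProperFilter (within (@int_simplex R d) (nbhs s)).
Proof. by move=> /closure_int_simplex; exact: within_nbhs_proper. Qed.

Lemma compact_simplex : compact (@simplex R d).
Proof.
have -> : simplex = [set v : 'rV[R]_d | forall j, (`[0, 1]%classic : set R) (v ord0 j)]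
    `&` (@dsum R d @^-1` [set x | x <= 1]).
  apply/seteqP; split => v /=.
    move=> [v01 v1]; split; last by rewrite -simplex_l1norm.
    by move=> j; rewrite in_itv/= v01.
  move=> [v01 v1]; apply/simplexP; split => // j.
  by have := v01 j; rewrite in_itv/= => /andP[].
apply: compact_closedI.
  exact: (@rV_compact R d (fun=> `[0, 1]%classic) (fun=> @segment_compact R 0 1)).
apply: preimage_closed; last exact: closed_le.
suff cd : continuous (@dsum R d) by move=> v _; exact: cd.
apply: continuous_big; first exact: add_continuous.
by move=> j _; exact: coord_continuous.
Qed.

(** A step of length [r / 2] stays in the simplex: stepping down in coordinate [j] forces that
    coordinate to be positive, stepping up in one coordinate forces the sum below 1. *)
Lemma interior_simplex : (0 < d)%N -> (@simplex R d)° `<=` @int_simplex R d.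
Proof.
move=> d0 v; rewrite /interior => /nbhs_ballP[r /= r0 vr].
have [r20 r2r] : 0 < r / 2 /\ r / 2 < r.
  by split; [rewrite divr_gt0|rewrite ltr_pdivrMr// mulr2n mulrDr mulr1 ltrDr].
have vb j (a : R) : `|a| < r -> simplex (v + a *: delta_mx ord0 j).
  move=> ar; apply: vr; split => // i k; rewrite !mxE /ball/= opprD addrA subrr sub0r.
  rewrite normrN normrM (le_lt_trans _ ar)// ler_piMr//.
  by case: (_ && _); rewrite ?normr1 ?normr0.
apply/int_simplexP; split => [j|].
  have /simplexP[/(_ j) + _] : simplex (v + - (r / 2) *: delta_mx ord0 j).
    by apply: vb; rewrite normrN gtr0_norm.
  by rewrite !mxE !eqxx mulr1 subr_ge0; exact: lt_le_trans.
have /simplexP[_ +] : simplex (v + (r / 2) *: delta_mx ord0 (Ordinal d0)).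
  by apply: vb; rewrite gtr0_norm.
rewrite dsumD dsumZ.
have -> : dsum (delta_mx ord0 (Ordinal d0) : 'rV[R]_d) = 1.
  rewrite /dsum (bigD1 (Ordinal d0))//= mxE !eqxx big1 ?addr0// => k kj.
  by rewrite mxE (negbTE kj) andbF.
by rewrite mulr1; apply: lt_le_trans; rewrite ltrDl.
Qed.

(** The norm on row vectors is the maximum norm, so its square is one of the summands. *)
Lemma norm_sqr_le v : `|v| ^+ 2 <= \sum_(j < d) v ord0 j ^+ 2.
Proof.
have [->|v0] := eqVneq v 0.
  by rewrite normr0 expr0n/= sumr_ge0// => j _; rewrite sqr_ge0.
have [|[i j] /= vij] := @mx_norm_neq0 _ _ _ v.
  by rewrite -[mx_norm v]/(`|v|) normr_eq0.
rewrite -[`|v|]/(mx_norm v) vij (ord1 i) -normrX ger0_norm ?sqr_ge0//.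
by rewrite (bigD1 j)//= lerDl sumr_ge0// => k _; rewrite sqr_ge0.
Qed.

(** Cauchy-Schwarz against the constant 1, obtained by summing
    [a j * a k <= (a j ^+ 2 + a k ^+ 2) / 2]. *)
Lemma sqr_sum_le (a : 'I_d -> R) :
  (\sum_j a j) ^+ 2 <= d%:R * \sum_j a j ^+ 2.
Proof.
have -> : (\sum_j a j) ^+ 2 = \sum_j \sum_k a j * a k.
  by rewrite expr2 mulr_suml; apply: eq_bigr => j _; rewrite mulr_sumr.
apply: (@le_trans _ _ (\sum_j \sum_k (a j ^+ 2 + a k ^+ 2) / 2)).
  apply: ler_sum => j _; apply: ler_sum => k _.
  have := sqr_ge0 (a j - a k); nra.
rewrite le_eqVlt; apply/orP; left; apply/eqP.
transitivity (\sum_j (a j ^+ 2 * d%:R + \sum_k a k ^+ 2) / 2).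
  apply: eq_bigr => j _; rewrite -mulr_suml big_split/= sumr_const card_ord.
  by rewrite mulr_natr.
rewrite -mulr_suml big_split/= -mulr_suml sumr_const card_ord -[X in _ + X]mulr_natl.
by field.
Qed.

End simplex_geometry.

Section simplex_taylor.
Context {R : realType} {d : nat}.
Implicit Types (s t v : 'rV[R]_d) (h m : 'rV[R]_d -> R) (j k : 'I_d).
Local Notation S := (@simplex R d).
Local Notation I := (@int_simplex R d).

Lemma simplex_partial_continuous h j : simplex_C1 h ->
  {within S, continuous (simplex_partial j h)}.
Proof.
move=> [_ _ ch]; apply: within_lim_continuous => s Ss; last exact: ch.
exact: proper_within_int_simplex.
Qed.

Lemma simplex_partialE h j s : simplex_C1 h -> I s ->
  simplex_partial j h s = 'D_(delta_mx ord0 j) h s.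
Proof.
move=> [_ _ ch] Is.
apply: (within_lim_self (h := fun y => 'D_(delta_mx ord0 j) h y)) => //.
  exact/proper_within_int_simplex/sub_int_simplex.
exact/ch/sub_int_simplex.
Qed.

Lemma simplex_is_derive_line h s v (u : R) : simplex_C1 h -> I (s + u *: v) ->
  is_derive u (1 : R) (fun w : R => h (s + w *: v))
    (\sum_(j < d) v ord0 j * simplex_partial j h (s + u *: v)).
Proof.
move=> C1h Iu; have [_ dh _] := C1h.
have dl := is_derive_line (dh _ Iu); apply: is_derive_eq.
rewrite [X in 'd _ _ X = _]row_sum_delta linear_sum; apply: eq_bigr => j _.
by rewrite linearZ/= -deriveE ?simplex_partialE//; exact: dh.
Qed.

Lemma simplex_segment s t (u : R) : S s -> I t -> 0 <= u <= 1 -> S (s + u *: (t - s)).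
Proof.
move=> Ss It /andP[]; rewrite le_eqVlt => /predU1P[<- _|u0 u1].
  by rewrite scale0r addr0.
by apply/sub_int_simplex/int_simplex_segment => //; rewrite u0.
Qed.

Lemma within_segment_continuous h s t : {within S, continuous h} -> S s -> I t ->
  {within `[0, 1], continuous (fun u : R => h (s + u *: (t - s)))}.
Proof.
move=> /within_continuous_epsP ch Ss It.
apply/within_continuous_epsP => u u01 e e0.
have Su (w : R) : `[0, 1]%classic w -> S (s + w *: (t - s)).
  by rewrite /= in_itv/= => ?; exact: simplex_segment.
have [r r0 hr] := ch _ (Su u u01) e e0.
have n0 : 0 < `|t - s| + 1 by rewrite ltr_wpDl.
exists (r / (`|t - s| + 1)); first by rewrite divr_gt0.
move=> w w01; rewrite ltr_pdivlMr// => uw.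
apply: hr; first exact: Su.
rewrite opprD addrACA subrr add0r -scalerBl normrZ.
by rewrite (le_lt_trans _ uw)// ler_wpM2l// lerDl.
Qed.

(** Mean value theorem on the segment from [s] to [t]; the extended partial derivatives are bounded
    because they are continuous on the compact simplex. *)
Lemma C1_lipschitz_int m : simplex_C1 m ->
  exists2 M : R, 0 <= M & forall s t, I s -> I t ->
    `|m t - m s| <= M * \sum_(j < d) `|t ord0 j - s ord0 j|.
Proof.
move=> C1m; have [cm _ _] := C1m.
have /choice[M MP] : forall j, exists M : R, 0 <= M /\
    forall s, S s -> `|simplex_partial j m s| <= M.
  move=> j; have [M M0 MP] := compact_bounded_fun compact_simplex
    (@simplex_partial_continuous m j C1m).
  by exists M.
exists (\sum_j M j); first by apply: sumr_ge0 => j _; have [] := MP j.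
move=> s t Is It.
have [|c c01] := MVT ltr01 _ (within_segment_continuous cm (sub_int_simplex Is) It)
    (df := fun u => \sum_(j < d) (t - s) ord0 j * simplex_partial j m (s + u *: (t - s))).
  move=> u; rewrite in_itv/= => /andP[u0 u1]; apply: simplex_is_derive_line => //.
  by apply: int_simplex_segment => //; [exact: sub_int_simplex|rewrite u0 ltW].
rewrite scale1r scale0r addr0 subrKC subr0 mulr1 => ->.
rewrite (le_trans (ler_norm_sum _ _ _))// mulr_sumr ler_sum// => j _.
rewrite normrM !mxE mulrC ler_wpM2r//.
have [Mj0 MjP] := MP j.
apply: (@le_trans _ _ (M j)).
  apply: MjP; apply: simplex_segment => //; first exact: sub_int_simplex.
  by move: c01; rewrite in_itv/= => /andP[c0 c1]; rewrite !ltW.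
by rewrite (bigD1 j)//= lerDl sumr_ge0// => k _; have [] := MP k.
Qed.

Definition simplex_taylor2 m s t : R :=
  m s + \sum_(j < d) (t ord0 j - s ord0 j) * simplex_partial j m s +
  2^-1 * \sum_(j < d) \sum_(k < d) (t ord0 j - s ord0 j) * (t ord0 k - s ord0 k) *
    simplex_partial j (simplex_partial k m) s.

Lemma C2_taylor m : simplex_C2 m -> forall e : R, 0 < e ->
  exists2 C : R, 0 <= C & forall s t, S s -> I t ->
    `|m t - simplex_taylor2 m s t| <=
      e * \sum_(j < d) (t ord0 j - s ord0 j) ^+ 2 +
      C * \sum_(j < d) (t ord0 j - s ord0 j) ^+ 4.
Proof.
move=> [C1m C1p] e e0; have [cm _ _] := C1m.
have d0 : 0 <= d%:R :> R by [].
have e'0 : 0 < e / (d%:R + 1) by rewrite divr_gt0// ltr_wpDl.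
(* The squared sum of the [|v ord0 j|] costs a factor [d] by Cauchy-Schwarz; dividing by [d + 1]
   absorbs it. *)
set e' := e / _ in e'0.
have [H HE] : exists H, forall j k, H j k = simplex_partial j (simplex_partial k m).
  by exists (fun j k => simplex_partial j (simplex_partial k m)).
have cH j k : {within S, continuous (H j k)}.
  by rewrite HE; exact: (@simplex_partial_continuous _ j (C1p k)).
have /choice[r rP] : forall p : 'I_d * 'I_d, exists r : R, 0 < r /\
    forall x y, S x -> S y -> `|x - y| < r -> `|H p.1 p.2 x - H p.1 p.2 y| < e'.
  move=> p; have [r r0 rP] := compact_uniformly_continuous compact_simplex (cH p.1 p.2) e'0.
  by exists r.
have /choice[M MP] : forall p : 'I_d * 'I_d, exists M : R, 0 <= M /\
    forall x, S x -> `|H p.1 p.2 x| <= M.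
  move=> p; have [M M0 MP] := compact_bounded_fun compact_simplex (cH p.1 p.2).
  by exists M.
(* When [|v|] is at least [r p], the crude bound [2 * M p] is at most [2 * M p / r p ^+ 2] times
   [q]; summing over [p] serves all pairs at once. *)
pose C0 := \sum_p (2 * M p / r p ^+ 2).
have C00p p : 0 <= 2 * M p / r p ^+ 2.
  by rewrite divr_ge0 ?sqr_ge0// mulr_ge0//; have [] := MP p.
have C00 : 0 <= C0 by exact: sumr_ge0.
exists (d%:R * d%:R * C0); first by rewrite !mulr_ge0.
move=> s t Ss It.
pose v := t - s.
have vE j : v ord0 j = t ord0 j - s ord0 j by rewrite !mxE.
pose q := \sum_(j < d) v ord0 j ^+ 2.
have q0 : 0 <= q by apply: sumr_ge0 => j _; exact: sqr_ge0.
have Iseg (u : R) : u \in `]0, 1[ -> I (s + u *: v).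
  by rewrite in_itv/= => /andP[u0 u1]; apply: int_simplex_segment => //; rewrite u0 ltW.
pose psi u := \sum_(k < d) v ord0 k * simplex_partial k m (s + u *: v).
pose chi u := \sum_(k < d) v ord0 k * \sum_(j < d) v ord0 j * H j k (s + u *: v).
have [|||u u01|c c01] := @taylor_order2 R (fun u => m (s + u *: v)) psi chi.
- exact: within_segment_continuous.
- apply/subspace_continuousP => u u01; apply: cvg_big => [|k _]; first exact: add_continuous.
  apply: cvgM; first exact: cvg_cst.
  have [ck _ _] := C1p k.
  by have /subspace_continuousP := within_segment_continuous ck Ss It; apply.
- by move=> u u01; apply: simplex_is_derive_line => //; exact: Iseg.
- have dk k : is_derive u 1 (fun w : R => v ord0 k * simplex_partial k m (s + w *: v))
      (v ord0 k * \sum_(j < d) v ord0 j * H j k (s + u *: v)).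
    have dd : is_derive u 1 (fun w : R => simplex_partial k m (s + w *: v))
        (\sum_(j < d) v ord0 j * H j k (s + u *: v)).
      under eq_bigr do rewrite HE.
      exact: (simplex_is_derive_line (C1p k) (Iseg _ u01)).
    exact: is_derive_eq.
  rewrite (_ : psi = \sum_(k < d) (fun w : R => v ord0 k * simplex_partial k m (s + w *: v))).
    exact: is_derive_sum.
  by apply/funext => w; rewrite fct_sumE.
rewrite scale1r scale0r addr0 subrKC => mt.
have chiE : chi 0 / 2 = 2^-1 * \sum_(j < d) \sum_(k < d)
    (t ord0 j - s ord0 j) * (t ord0 k - s ord0 k) * H j k s.
  rewrite mulrC; congr (_ * _); rewrite /chi.
  under eq_bigr do rewrite mulr_sumr.
  rewrite exchange_big/=; apply: eq_bigr => j _; apply: eq_bigr => k _.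
  by rewrite scale0r addr0 !vE mulrCA mulrA.
have psiE : psi 0 = \sum_(j < d) (t ord0 j - s ord0 j) * simplex_partial j m s.
  by apply: eq_bigr => j _; rewrite scale0r addr0 vE.
have -> : m t - simplex_taylor2 m s t = (chi c - chi 0) / 2.
  have T2 : simplex_taylor2 m s t = m s + psi 0 + chi 0 / 2.
    rewrite psiE chiE; congr (_ + 2^-1 * _).
    by apply: eq_bigr => j _; apply: eq_bigr => k _; rewrite HE.
  by rewrite T2 mt mulrBl opprD addrACA subrr add0r.
have Hc (p : 'I_d * 'I_d) : `|H p.1 p.2 (s + c *: v) - H p.1 p.2 s| <= e' + C0 * q.
  have Sc := sub_int_simplex (Iseg c c01).
  have [rp0 rpP] := rP p; have [Mp0 MpP] := MP p.
  have [vr|rv] := ltP `|v| (r p).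
    rewrite ler_wpDr ?mulr_ge0// ltW// rpP// addrAC subrr add0r normrZ.
    move: c01; rewrite in_itv/= => /andP[c0 c1].
    by rewrite gtr0_norm// (le_lt_trans _ vr)// ler_piMl// ltW.
  have rq : r p ^+ 2 <= q.
    apply: le_trans (norm_sqr_le v).
    by rewrite lerXn2r ?nnegrE// ltW.
  rewrite ler_wpDl ?(ltW e'0)//.
  apply: (@le_trans _ _ (2 * M p)).
    by rewrite (le_trans (ler_normB _ _))// mulr2n mulrDl mul1r lerD// MpP.
  apply: (@le_trans _ _ (2 * M p / r p ^+ 2 * q)).
    by rewrite mulrAC ler_pdivlMr ?exprn_gt0// ler_wpM2l// mulr_ge0.
  rewrite ler_wpM2r// /C0 (bigD1 p)//= lerDl.
  by apply: sumr_ge0 => p' _.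
have chi_le : `|chi c - chi 0| <= (\sum_j `|v ord0 j|) ^+ 2 * (e' + C0 * q).
  have -> : chi c - chi 0 = \sum_(k < d) \sum_(j < d)
      v ord0 k * v ord0 j * (H j k (s + c *: v) - H j k s).
    rewrite -sumrB; apply: eq_bigr => k _; rewrite -mulrBr -sumrB mulr_sumr.
    by apply: eq_bigr => j _; rewrite scale0r addr0 -mulrBr mulrA.
  rewrite (le_trans (ler_norm_sum _ _ _))// expr2 -mulrA mulr_suml.
  apply: ler_sum => k _; rewrite (le_trans (ler_norm_sum _ _ _))//.
  rewrite mulr_suml mulr_sumr; apply: ler_sum => j _.
  rewrite !normrM mulrA ler_wpM2l ?mulr_ge0//.
  exact: (Hc (j, k)).
have v1_le : (\sum_j `|v ord0 j|) ^+ 2 <= d%:R * q.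
  have := sqr_sum_le (fun j => `|v ord0 j|).
  by under [X in _ <= _ * X]eq_bigr do rewrite real_normK ?num_real//.
have q2_le : q ^+ 2 <= d%:R * \sum_(j < d) v ord0 j ^+ 4.
  have := sqr_sum_le (fun j => v ord0 j ^+ 2).
  by under [X in _ <= _ * X]eq_bigr do rewrite -exprM.
have -> : \sum_(j < d) (t ord0 j - s ord0 j) ^+ 2 = q.
  by apply: eq_bigr => j _; rewrite vE.
under eq_bigr do rewrite -vE.
have w0 : 0 <= e' + C0 * q by rewrite addr_ge0 ?mulr_ge0// ltW.
rewrite normrM [`|2^-1|]ger0_norm ?invr_ge0//.
apply: (@le_trans _ _ `|chi c - chi 0|).
  by rewrite ler_piMr// invf_le1// ler1n.
apply: (le_trans chi_le).
apply: (@le_trans _ _ (d%:R * q * (e' + C0 * q))); first exact: ler_wpM2r.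
have -> : d%:R * q * (e' + C0 * q) = d%:R * e' * q + d%:R * C0 * q ^+ 2 by ring.
apply: lerD.
  rewrite ler_wpM2r// /e' mulrCA ler_piMr ?(ltW e0)//.
  by rewrite ler_pdivrMr ?ltr_wpDl// mul1r lerDl.
rewrite [leRHS](_ : _ = d%:R * C0 * (d%:R * \sum_(j < d) v ord0 j ^+ 4)); last by ring.
by rewrite ler_wpM2l// mulr_ge0.
Qed.

End simplex_taylor.

(** * Cells and bias *)

Section cells.
Context {R : realType} {d : nat}.
Local Notation leb := (@lebesgue_rV R d).
Local Notation S := (@simplex R d).
Local Notation I := (@int_simplex R d).
Implicit Types (s t v : 'rV[R]_d) (b e c : R).

Lemma measurable_closed_rV (A : set 'rV[R]_d) : closed A -> measurable A.
Proof.
move=> cA; rewrite -[A]setCK; apply: measurableC; apply: open_measurable_rV.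
exact: closed_openC.
Qed.

Lemma measurable_boundary (A : set 'rV[R]_d) : measurable (boundary A).
Proof.
apply: measurableD; first by apply: measurable_closed_rV; exact: closed_closure.
by apply: open_measurable_rV; exact: open_interior.
Qed.

(** [diam] is a supremum, meaningful once the distances are bounded: in the simplex they are at most
    the square root of [d]. *)
Lemma l2norm_diam (A : set 'rV[R]_d) s t : A `<=` S -> A s -> A t ->
  l2norm (s - t) <= diam A.
Proof.
move=> AS As At; apply: ub_le_sup; last by exists s => //; exists t.
exists (Num.sqrt d%:R) => _ [x Ax [y Ay <-]].
rewrite ler_wsqrtr// -[leRHS]mulr1 mulr_natl -[X in _ *+ X](card_ord d) -sumr_const.
apply: ler_sum => j _; rewrite !mxE.
have /andP[x0 x1] := (AS x Ax).1 j; have /andP[y0 y1] := (AS y Ay).1 j.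
rewrite -real_normK ?num_real// expr_le1// ler_norml; lra.
Qed.

Lemma sum_coord_diam (A : set 'rV[R]_d) s t : A `<=` S -> A s -> A t ->
  \sum_(j < d) `|t ord0 j - s ord0 j| <= d%:R * diam A.
Proof.
move=> AS As At.
rewrite mulr_natl -[X in _ *+ X](card_ord d) -sumr_const.
apply: ler_sum => j _; apply: le_trans (l2norm_diam AS At As).
rewrite -sqrtr_sqr ler_wsqrtr// (bigD1 j)//= !mxE lerDl.
by apply: sumr_ge0 => k _; exact: sqr_ge0.
Qed.

(** Monotonicity of moments when the pointwise bound holds only off a null set and where the density
    does not vanish, that is, for interior points of the cells. *)
Lemma has_moment_norm_le (alpha : 'rV[R]_d) (beta : R) (h g : 'rV[R]_d -> R)
    c e (N : set 'rV[R]_d) :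
  (forall j, 1 <= alpha ord0 j) -> 1 <= beta ->
  has_moment alpha beta h c -> has_moment alpha beta g e ->
  measurable N -> leb N = 0%E ->
  (forall v, ~ N v -> dir_density alpha beta v != 0 -> `|h v| <= g v) ->
  `|c| <= e.
Proof.
move=> a1 b1 [ih hc] [ig ge] mN N0 hg.
rewrite -lee_fin -[(`|c|)%:E]/(`|c%:E|)%E -hc -ge.
have mNC : measurable (~` N) by exact: measurableC.
rewrite (negligible_integral mN _ ih)// (negligible_integral mN _ ig)// setTD.
apply: (le_trans (le_abse_integral _ _ _)) => //.
  by apply: measurable_funTS; exact: measurable_int ih.
apply: ge0_le_integral => //.
- by apply: measurableT_comp => //; apply: measurable_funTS; exact: measurable_int ih.
- by apply: measurable_funTS; exact: measurable_int ig.
- move=> v Nv /=; rewrite lee_fin normrM (ger0_norm (dir_density_ge0 a1 b1 v)).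
  have [->|K0] := eqVneq (dir_density alpha beta v) 0; first by rewrite !mulr0.
  by rewrite ler_wpM2r ?dir_density_ge0// hg.
Qed.

Section fixed_cells.
Variables (n : nat) (x : 'I_n -> 'rV[R]_d) (B : 'I_n -> set 'rV[R]_d).
Hypothesis d_gt0 : (0 < d)%N.
Hypothesis compactB : forall i, compact (B i).
Hypothesis BS : forall i, B i `<=` S.
Hypothesis disjB : forall i j, i != j -> (B i)° `&` (B j)° = set0.
Hypothesis coverB : \bigcup_(i in [set: 'I_n]) B i = S.
Hypothesis xB : forall i, (B i)° (x i).
Hypothesis bndB : forall i, leb (boundary (B i)) = 0%E.

Let closedB i : closed (B i).
Proof. by apply: compact_closed => //; exact: norm_hausdorff. Qed.

Let mB i : measurable (B i).
Proof. exact: measurable_closed_rV. Qed.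

Let mBo i : measurable (B i)°.
Proof. by apply: open_measurable_rV; exact: open_interior. Qed.

Let BoI i : (B i)° `<=` I.
Proof. by move=> v Bv; apply: interior_simplex => //; exact: interiorS Bv. Qed.

(** The null set off which each point of the simplex is interior to some cell. *)
Let N := \big[setU/set0]_(i < n) boundary (B i).

Let mN : measurable N.
Proof. by apply: bigsetU_measurable => i _; exact: measurable_boundary. Qed.

Let N0 : leb N = 0%E.
Proof.
apply: measure_negligible => //; rewrite /N.
elim/big_ind : _ => [|A1 A2|i _]; [exact: negligible_set0|exact: negligibleU|].
by apply/negligibleP; [exact: measurable_boundary|exact: bndB].
Qed.

Lemma cell_interior v : S v -> ~ N v -> exists i, (B i)° v.
Proof.
rewrite -coverB => -[i _ Biv] Nv; exists i; apply: contrapT => nBv; apply: Nv.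
rewrite /N -bigcup_seq; exists i; first by rewrite /= mem_index_enum.
by split => //; exact: subset_closure.
Qed.

Section fixed_center.
Variables (s : 'rV[R]_d) (b : R).
Hypotheses (Ss : S s) (b0 : 0 < b).
Let alpha := b^-1 *: s + const_mx 1.
Let beta := (1 - dsum s) / b + 1.
Let w i := \int[leb]_(t in B i) dirichlet_kernel s b t.

Let alpha1 j : 1 <= alpha ord0 j.
Proof.
rewrite !mxE lerDr mulr_ge0// ?invr_ge0 ?(ltW b0)//.
by move/simplexP: Ss => [].
Qed.

Let beta1 : 1 <= beta.
Proof.
by rewrite /beta lerDr divr_ge0 ?(ltW b0)// subr_ge0; move/simplexP: Ss => [].
Qed.

(** The weight of a cell is an integral over all of [B i]; passing to the interior only removes the
    null boundary, since [B i] is closed. *)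
Lemma has_moment_cell i : has_moment alpha beta \1_((B i)°) (w i).
Proof.
have iK : leb.-integrable setT (fun v => (1 * dir_density alpha beta v)%:E).
  by have [] := has_moment1 alpha1 beta1.
have E : (fun v => (\1_((B i)°) v * dir_density alpha beta v)%:E) =
    ((fun v => (1 * dir_density alpha beta v)%:E) \_ ((B i)°)).
  apply/funext => v; rewrite patchE indicE.
  by case: (v \in _); rewrite ?mul0r.
rewrite /has_moment E; split.
  apply/(integrable_mkcond _ (mBo i)).
  exact: (integrableS measurableT (mBo i) _ iK).
rewrite -integral_mkcond.
have iB : leb.-integrable (B i) (fun v => (1 * dir_density alpha beta v)%:E).
  exact: (integrableS measurableT (mB i) _ iK).
have -> : (B i)° = B i `\` boundary (B i).
  rewrite /boundary -(closure_id (B i)).1// setDD setIC.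
  by apply/esym/setIidl; exact: interior_subset.
rewrite -negligible_integral//; last 2 first.
  exact: measurable_boundary.
  exact: bndB.
rewrite /w /Rintegral -[LHS]fineK; last exact: integrable_fin_num.
congr (fine _)%:E; apply: eq_integral => v; rewrite inE => /BS Sv.
by rewrite mul1r (dirichlet_kernelE Ss b0 Sv).
Qed.

(** The mean of the estimator is the moment of the step function equal to [m (x i)] on the interior
    of [B i], so it can be compared pointwise with the Taylor polynomial. *)
Lemma gm_mean_remainder (m : 'rV[R]_d -> R) (delta M e C : R) :
  0 <= M ->
  (forall i t, (B i)° t -> \sum_(j < d) `|t ord0 j - x i ord0 j| <= delta) ->
  (forall s t, I s -> I t ->
    `|m t - m s| <= M * \sum_(j < d) `|t ord0 j - s ord0 j|) ->
  (forall t, I t -> `|m t - simplex_taylor2 m s t| <=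
      e * \sum_(j < d) (t ord0 j - s ord0 j) ^+ 2 +
      C * \sum_(j < d) (t ord0 j - s ord0 j) ^+ 4) ->
  forall (P0 : R) (c2 c4 : 'I_d -> R),
  has_moment alpha beta (simplex_taylor2 m s) P0 ->
  (forall j, has_moment alpha beta (fun v => (v ord0 j - s ord0 j) ^+ 2) (c2 j)) ->
  (forall j, has_moment alpha beta (fun v => (v ord0 j - s ord0 j) ^+ 4) (c4 j)) ->
  `|\sum_(i < n) m (x i) * w i - P0| <=
    M * delta + e * \sum_(j < d) c2 j + C * \sum_(j < d) c4 j.
Proof.
move=> M0 xdelta mM mT P0 c2 c4 hP h2 h4.
have hstep : has_moment alpha beta
    (fun v => \sum_(i < n) m (x i) * \1_((B i)°) v) (\sum_(i < n) m (x i) * w i).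
  by apply: has_moment_sum => i _; apply: has_momentZ; exact: has_moment_cell.
have hdiff := has_momentD hstep (has_momentZ (-1) hP).
have hG := has_momentD (has_momentD (has_momentZ (M * delta) (has_moment1 alpha1 beta1))
  (has_momentZ e (has_moment_sum (index_enum _) (P := xpredT) (fun j _ => h2 j))))
  (has_momentZ C (has_moment_sum (index_enum _) (P := xpredT) (fun j _ => h4 j))).
have := has_moment_norm_le alpha1 beta1 hdiff hG mN N0.
rewrite mulN1r mulr1; apply => v Nv Kv.
have Sv : S v by apply: contrapT => /(@kdens_out _ _ s b) /eqP; rewrite (negbTE Kv).
have [i Bv] := cell_interior Sv Nv.
(* The interiors are disjoint, so a single term of the step function survives at [v]. *)
rewrite (bigD1 i)//= big1 ?addr0; last first.
  move=> k ki; rewrite indicE memNset ?mulr0// => Bkv.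
  by have := disjB ki; rewrite -subset0 => /(_ v); apply.
rewrite indicE mem_set// !mulr1 mulN1r.
(* Through [m v]: the Lipschitz bound compares the two interior points [x i] and [v], and the Taylor
   bound does the rest. *)
rewrite -(subrKA (m v)) (le_trans (ler_normD _ _))// -addrA lerD//.
  rewrite distrC (le_trans (mM _ _ (BoI (xB i)) (BoI Bv)))//.
  by rewrite ler_wpM2l// xdelta.
by apply: mT; exact: BoI Bv.
Qed.

End fixed_center.

End fixed_cells.

End cells.

(** * The Taylor polynomial integrated against the kernel *)

Section taylor_moment.
Context {R : realType} {d : nat}.
Local Notation S := (@simplex R d).
Local Notation D := (d.+1%:R : R).
Implicit Types (s : 'rV[R]_d) (b : R).

Definition kmean s b (j : 'I_d) : R := (s ord0 j + b) / (1 + b * D) - s ord0 j.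

Definition kcov s b (j k : 'I_d) : R :=
  (s ord0 j + b) / (1 + b * D) *
     ((s ord0 k + b + b * (j == k)%:R) / (1 + b * (D + 1)))
    - s ord0 j * ((s ord0 k + b) / (1 + b * D))
    - s ord0 k * ((s ord0 j + b) / (1 + b * D)) + s ord0 j * s ord0 k.

Lemma has_moment_taylor2 (m : 'rV[R]_d -> R) s b : S s -> 0 < b ->
  has_moment (b^-1 *: s + const_mx 1) ((1 - dsum s) / b + 1) (simplex_taylor2 m s)
    (m s + \sum_(j < d) simplex_partial j m s * kmean s b j +
     2^-1 * \sum_(j < d) \sum_(k < d)
       simplex_partial j (simplex_partial k m) s * kcov s b j k).
Proof.
move=> Ss b0.
have h0 := has_momentZ (m s) (kdens_mass Ss b0).
have h1 := has_moment_sum (index_enum _) (P := xpredT)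
  (fun j _ => has_momentZ (simplex_partial j m s) (kdens_mean Ss b0 j)).
have h2 := has_moment_sum (index_enum _) (P := xpredT)
  (fun j _ => has_moment_sum (index_enum _) (P := xpredT)
    (fun k _ => has_momentZ (simplex_partial j (simplex_partial k m) s)
      (kdens_covariance Ss b0 j k))).
have := has_momentD (has_momentD h0 h1) (has_momentZ 2^-1 h2).
move=> /has_momentE; apply=> [v|]; last by rewrite mulr1.
rewrite /simplex_taylor2 mulr1; congr (_ + _ + 2^-1 * _).
  by apply: eq_bigr => j _; rewrite mulrC.
by apply: eq_bigr => j _; apply: eq_bigr => k _; rewrite mulrC.
Qed.

(** The first-order parts [b * (1 - D * s_j)] of [kmean] and [b * s_j * (1_{j = k} - s_k)] of [kcov]
    add up to [b * gm_bias_coef m s]; the remainders are of order [b ^+ 2] and are multiplied by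
    bounded derivatives. *)
Lemma taylor2_moment_bias (m : 'rV[R]_d -> R) : simplex_C2 m ->
  exists2 A : R, 0 <= A & forall s b, S s -> 0 < b <= 1 ->
    `|m s + \sum_(j < d) simplex_partial j m s * kmean s b j +
     2^-1 * \sum_(j < d) \sum_(k < d)
       simplex_partial j (simplex_partial k m) s * kcov s b j k
     - m s - b * gm_bias_coef m s| <= A * b ^+ 2.
Proof.
move=> [C1m C1p].
have D0 : 0 <= D by [].
have [C1 hC1] := mean_remainder D0.
have [C2 hC2] := covariance_remainder D0.
have /choice[M MP] : forall j, exists M : R, 0 <= M /\
    forall s, S s -> `|simplex_partial j m s| <= M.
  move=> j; have [M M0 MP] := compact_bounded_fun compact_simplex
    (@simplex_partial_continuous _ _ m j C1m).
  by exists M.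
have [H HE] : exists H, forall j k, H j k = simplex_partial j (simplex_partial k m).
  by exists (fun j k => simplex_partial j (simplex_partial k m)).
have /choice[L LP] : forall p : 'I_d * 'I_d, exists L : R, 0 <= L /\
    forall s, S s -> `|H p.1 p.2 s| <= L.
  move=> p; rewrite HE; have [L L0 LP] := compact_bounded_fun compact_simplex
    (@simplex_partial_continuous _ _ _ p.1 (C1p p.2)).
  by exists L.
exists (\sum_j M j * `|C1| + 2^-1 * \sum_j \sum_k L (j, k) * `|C2|).
  apply: addr_ge0; first by apply: sumr_ge0 => j _; rewrite mulr_ge0//; have [] := MP j.
  rewrite mulr_ge0 ?invr_ge0//; apply: sumr_ge0 => j _; apply: sumr_ge0 => k _.
  by rewrite mulr_ge0//; have [] := LP (j, k).
move=> s b Ss b01.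
have s01 j : 0 <= s ord0 j <= 1 by case: Ss => /(_ j).
rewrite (_ : _ - b * _ =
    \sum_(j < d) simplex_partial j m s * (kmean s b j - b * (1 - D * s ord0 j)) +
    2^-1 * \sum_(j < d) \sum_(k < d) H j k s *
      (kcov s b j k - b * (s ord0 j * ((j == k)%:R - s ord0 k)))); last first.
  have -> : gm_bias_coef m s =
      \sum_(j < d) (1 - D * s ord0 j) * simplex_partial j m s +
      2^-1 * \sum_(j < d) \sum_(k < d) s ord0 j * ((j == k)%:R - s ord0 k) * H j k s.
    congr (_ + 2^-1 * _).
    by apply: eq_bigr => j _; apply: eq_bigr => k _; rewrite HE.
  have -> : \sum_(j < d) \sum_(k < d)
        simplex_partial j (simplex_partial k m) s * kcov s b j k =
      \sum_(j < d) \sum_(k < d) H j k s * kcov s b j k.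
    by apply: eq_bigr => j _; apply: eq_bigr => k _; rewrite HE.
  have -> : \sum_(j < d) simplex_partial j m s * (kmean s b j - b * (1 - D * s ord0 j)) =
      \sum_(j < d) simplex_partial j m s * kmean s b j -
      b * \sum_(j < d) (1 - D * s ord0 j) * simplex_partial j m s.
    by rewrite mulr_sumr -sumrB; apply: eq_bigr => j _; ring.
  have -> : \sum_(j < d) \sum_(k < d) H j k s *
        (kcov s b j k - b * (s ord0 j * ((j == k)%:R - s ord0 k))) =
      \sum_(j < d) \sum_(k < d) H j k s * kcov s b j k -
      b * \sum_(j < d) \sum_(k < d) s ord0 j * ((j == k)%:R - s ord0 k) * H j k s.
    rewrite mulr_sumr -sumrB; apply: eq_bigr => j _.
    by rewrite mulr_sumr -sumrB; apply: eq_bigr => k _; ring.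
  by ring.
have abs_le (c : R) : c * b ^+ 2 <= `|c| * b ^+ 2 by rewrite ler_wpM2r ?sqr_ge0 ?ler_norm.
rewrite mulrDl (le_trans (ler_normD _ _))// lerD//.
  rewrite mulr_suml (le_trans (ler_norm_sum _ _ _))// ler_sum// => j _.
  rewrite normrM -mulrA ler_pM//; first by have [_] := MP j; apply.
  by apply: le_trans (abs_le C1); exact: hC1.
rewrite -mulrA normrM ger0_norm ?invr_ge0// ler_wpM2l ?invr_ge0//.
rewrite mulr_suml (le_trans (ler_norm_sum _ _ _))// ler_sum// => j _.
rewrite mulr_suml (le_trans (ler_norm_sum _ _ _))// ler_sum// => k _.
rewrite normrM -mulrA ler_pM//; first by have [_] := LP (j, k); apply.
apply: le_trans (abs_le C2); apply: hC2 => //.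
by case: (_ == _); rewrite ?lexx ?ler01.
Qed.

(** The leading term is [b * s_j * (1 - s_j)], which is at most [b]. *)
Lemma kcov_diag_le : exists2 A : R, 0 <= A & forall s b j, S s -> 0 < b <= 1 ->
  kcov s b j j <= b + A * b ^+ 2.
Proof.
have D0 : 0 <= D by [].
have [C2 hC2] := covariance_remainder D0.
exists `|C2| => // s b j Ss b01.
have /andP[s0 s1] : 0 <= s ord0 j <= 1 by case: Ss => /(_ j).
have h : kcov s b j j - b * (s ord0 j * (1 - s ord0 j)) <= C2 * b ^+ 2.
  rewrite /kcov eqxx; apply: (le_trans (ler_norm _)).
  by apply: hC2; rewrite ?s0 ?s1 ?lexx ?ler01.
have b0 : 0 < b by case/andP: b01.
have sb : b * (s ord0 j * (1 - s ord0 j)) <= b by rewrite ler_piMr ?(ltW b0)//; nra.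
have cb : C2 * b ^+ 2 <= `|C2| * b ^+ 2 by rewrite ler_wpM2r ?sqr_ge0 ?ler_norm.
lra.
Qed.

Lemma kfourth_le : exists2 A : R, 0 <= A & forall s b j, S s -> 0 < b <= 1 ->
  exists2 c, has_moment (b^-1 *: s + const_mx 1) ((1 - dsum s) / b + 1)
    (fun v => (v ord0 j - s ord0 j) ^+ 4) c & c <= A * b ^+ 2.
Proof.
have D0 : 0 <= D by [].
have [C hC] := fourth_moment_bound D0.
exists `|C| => // s b j Ss b01.
have b0 : 0 < b by case/andP: b01.
have s01 : 0 <= s ord0 j <= 1 by case: Ss => /(_ j).
eexists; first exact: (kdens_fourth Ss b0 j).
have /= h := hC b (s ord0 j) b01 s01.
apply: (le_trans (ler_norm _)); apply: (le_trans h).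
by rewrite ler_wpM2r ?sqr_ge0 ?ler_norm.
Qed.

End taylor_moment.

(** * Expectation of a linear combination of centred errors *)

Section estimator_expectation.
Context {disp : measure_display} {Omega : measurableType disp} {R : realType}
  (P : probability Omega R).

(* In the extended reals [+oo - +oo = -oo], so a vanishing integral has finite
   positive and negative parts. *)
Lemma integrable_expectation0 (X : {RV P >-> R}) : ('E_P[X] = 0)%E ->
  P.-integrable setT (EFin \o X).
Proof.
rewrite unlock => E0; apply/integrableP; split; first exact/measurable_EFinP.
have mX : measurable_fun setT (EFin \o X) by exact/measurable_EFinP.
have := E0; rewrite integralE.
set p := (\int[P]_w ((EFin \o X)^\+ w))%E; set q := (\int[P]_w ((EFin \o X)^\- w))%E.
have p0 : (0 <= p)%E by apply: integral_ge0 => w _; exact: funepos_ge0.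
have q0 : (0 <= q)%E by apply: integral_ge0 => w _; exact: funeneg_ge0.
move=> pq0.
have -> : (\int[P]_o `|(EFin \o X) o| = p + q)%E.
  rewrite -ge0_integralD//; last 2 first.
  - exact: measurable_funepos.
  - exact: measurable_funeneg.
  apply: eq_integral => o _.
  by rewrite -[RHS]/(((EFin \o X)^\+ \+ (EFin \o X)^\-)%E o) -fune_abse.
move: p q p0 q0 pq0 => [p| |] [q| |] //= _ _ _.
by rewrite -EFinD ltry.
Qed.

(** Having expectation 0 already makes each error integrable, which justifies linearity of the
    expectation. *)
Lemma expectation_linear_noise (n : nat) (eps : 'I_n -> {RV P >-> R}) (a w : 'I_n -> R) :
  (forall i, 'E_P[eps i] = 0)%E ->
  ('E_P[(fun o => \sum_(i < n) (a i + eps i o) * w i)%R] = (\sum_(i < n) a i * w i)%R%:E)%E.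
Proof.
move=> E0.
have ieps i : P.-integrable setT (EFin \o eps i) by exact: integrable_expectation0.
rewrite unlock.
have -> : (fun o => (\sum_(i < n) (a i + eps i o) * w i)%:E) =
    (fun o => \sum_(i < n) ((a i * w i)%:E + (w i)%:E * (EFin \o eps i) o))%E.
  apply/funext => o; rewrite -sumEFin; apply: eq_bigr => i _.
  by rewrite mulrDl EFinD /= [eps i o * _]mulrC EFinM.
have ic i : P.-integrable setT (fun=> (a i * w i)%:E).
  by apply: finite_measure_integrable_cst.
have iw i : P.-integrable setT (fun o => (w i)%:E * (EFin \o eps i) o)%E.
  exact: integrableZl.
rewrite integral_sum//; last by move=> i; exact: integrableD.
rewrite -sumEFin; apply: eq_bigr => i _.
rewrite integralD// integral_cst//= probability_setT mule1 integralZl//; last exact: ieps.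
have := E0 i; rewrite unlock => ->.
by rewrite mule0 adde0.
Qed.

End estimator_expectation.

Theorem proposition4p1 (R : realType) (d : nat)
  (x : forall n, 'I_n -> 'rV[R]_d)
  (f sigma2 m : 'rV[R]_d -> R)
  (disp : nat -> measure_display) (Omega : forall n, measurableType (disp n))
  (P : forall n, probability (Omega n) R)
  (eps : forall n, 'I_n -> {RV (P n) >-> R})
  (b : nat -> R) (B : forall n, 'I_n -> set 'rV[R]_d) :
  (0 < d)%N ->
  (* fixed design with density f *)
  (forall n (i : 'I_n), int_simplex (x n i)) ->
  design_density x f ->
  (* independent centred errors, with variance sigma2 at the design points *)
  (forall n, mutually_independent (P n) (fun i => eps n i : Omega n -> R)) ->
  (forall n (i : 'I_n), ('E_(P n)[eps n i] = 0)%E) ->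
  (forall n (i : 'I_n), ('V_(P n)[eps n i] = (sigma2 (x n i))%:E)%E) ->
  (* regularity *)
  [lipschitz f s | s in @simplex R d] ->
  [lipschitz sigma2 s | s in @simplex R d] ->
  simplex_C2 m ->
  (* positivity of the minima over the simplex *)
  0 < inf (f @` @simplex R d) ->
  0 < inf (sigma2 @` @simplex R d) ->
  (* bandwidth *)
  (forall n, (0 < n)%N -> 0 < b n) ->
  b n @[n --> \oo] --> (0 : R) ->
  (fun n : nat => n%:R `^ (- d%:R^-1) : R) =o_\oo b ->
  (* cells *)
  (forall n (i : 'I_n),
     [/\ convex_set (B n i), compact (B n i) & B n i `<=` @simplex R d]) ->
  (forall n (i j : 'I_n), i != j -> (B n i)° `&` (B n j)° = set0) ->
  (forall n, (0 < n)%N -> \bigcup_(i in [set: 'I_n]) B n i = @simplex R d) ->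
  (forall n (i : 'I_n), (B n i)° (x n i)) ->
  (forall n (i : 'I_n), lebesgue_rV (boundary (B n i)) = 0%E) ->
  (exists C : R, \forall n \near \oo, forall i : 'I_n,
     diam (B n i) <= C * n%:R `^ (- d%:R^-1)) ->
  (exists C : R, \forall n \near \oo, forall i : 'I_n,
     `|\int[@lebesgue_rV R d]_(t in B n i) f t - n%:R^-1|
       <= C * n%:R `^ (- 1 - d%:R^-1)) ->
  forall e : R, 0 < e -> \forall n \near \oo, forall s : 'rV[R]_d, simplex s ->
    (`| 'E_(P n)[(fun w =>
          gm_estimator (b n) (B n) (fun i => m (x n i) + eps n i w) s)%R]
        - (m s)%:E - (b n * gm_bias_coef m s)%:E | <= (e * b n)%:E)%E.
Proof.
move=> d_gt0 xI _ _ E0 _ _ _ C2m _ _ b_gt0 b_to0 n_o_b cellP disjB coverB xB bndB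
  [Cd diam_le] _ e e0.
have C1m : simplex_C1 m by case: C2m.
have [M M0 mM] := C1_lipschitz_int C1m.
have [A1 A10 biasP] := taylor2_moment_bias C2m.
have [A2 A20 covP] := @kcov_diag_le R d.
have [A4 A40 fourthP] := @kfourth_le R d.
have d0 : 0 <= d%:R :> R by [].
(* The bound [e * b n] is split into quarters: one for the cell diameters, one for the leading part
   of the second moments, one for all terms in [b n ^+ 2], and one of slack. *)
have e40 : 0 < e / 4 by rewrite divr_gt0.
have e'0 : 0 < e / 4 / (d%:R + 1) by rewrite divr_gt0// ltr_wpDl.
have [C C0 taylorP] := C2_taylor C2m e'0.
set e' := e / 4 / _ in e'0 taylorP.
have e'd : e' * d%:R <= e / 4.
  by rewrite /e' mulrAC ler_pdivrMr ?ltr_wpDl// ler_wpM2l ?(ltW e40)// lerDl.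
(* [K] gathers the coefficients of [b n ^+ 2] from the second moments, the fourth moments and the
   bias expansion. *)
pose K := e' * d%:R * A2 + C * (d%:R * A4) + A1.
have K0 : 0 <= K.
  by rewrite /K !addr_ge0 ?mulr_ge0// ltW.
(* Chosen so that [M * (d * |Cd|) * k] is at most [e / 4]; the absolute value covers a possibly
   negative [Cd]. *)
pose k := e / 4 / (M * (d%:R * `|Cd|) + 1).
have k0 : 0 < k by rewrite divr_gt0// ltr_wpDl// !mulr_ge0.
(* Below this threshold [b n <= 1], as the moment bounds require, and [K * b n <= e / 4]. *)
have r0 : 0 < Num.min 1 (e / 4 / (K + 1)).
  by rewrite lt_min ltr01 divr_gt0// ltr_wpDl.
near=> n => s Ss.
have n0 : (0 < n)%N by near: n; exact: nbhs_infty_gt.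
have bn0 : 0 < b n by exact: b_gt0.
have : `|b n| < Num.min 1 (e / 4 / (K + 1)).
  rewrite -normrN -sub0r; near: n.
  by move/cvgrPdist_lt: b_to0 => /(_ _ r0).
rewrite (gtr0_norm bn0) lt_min => /andP[bn1 bnK].
have rate : n%:R `^ (- d%:R^-1) <= k * b n.
  rewrite -(ger0_norm (powR_ge0 n%:R (- d%:R^-1))) -[X in _ <= k * X](gtr0_norm bn0).
  by near: n; move/eqoP: n_o_b => /(_ _ k0).
have diamn : forall i : 'I_n, diam (B n i) <= Cd * n%:R `^ (- d%:R^-1) by near: n.
have b01 : 0 < b n <= 1 by rewrite bn0 ltW.
have cB i : compact (B n i) by case: (cellP n i).
have BS i : B n i `<=` @simplex R d by case: (cellP n i).
pose w i := \int[@lebesgue_rV R d]_(t in B n i) dirichlet_kernel s (b n) t.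
rewrite (_ : 'E_(P n)[_]%E = (\sum_(i < n) m (x n i) * w i)%:E); last first.
  exact: expectation_linear_noise.
rewrite -!EFinB -[X in (X <= _)%E]/(`|_|%:E) lee_fin.
pose delta := d%:R * (`|Cd| * n%:R `^ (- d%:R^-1)).
have delta0 : 0 <= delta by rewrite !mulr_ge0// powR_ge0.
have delta_le i t : (B n i)° t -> \sum_(j < d) `|t ord0 j - x n i ord0 j| <= delta.
  move=> Bt; apply: le_trans (sum_coord_diam (BS i) (interior_subset (xB n i))
    (interior_subset Bt)) _.
  rewrite ler_wpM2l// (le_trans (diamn i))// ler_wpM2r ?powR_ge0//.
  exact: ler_norm.
have /choice[c4 c4P] : forall j, exists c, has_moment ((b n)^-1 *: s + const_mx 1)
    ((1 - dsum s) / b n + 1) (fun v => (v ord0 j - s ord0 j) ^+ 4) c /\ c <= A4 * b n ^+ 2.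
  by move=> j; have [c h1 h2] := fourthP s (b n) j Ss b01; exists c.
have rem := gm_mean_remainder d_gt0 cB BS (@disjB n) (coverB n n0) (xB n) (bndB n) Ss bn0
  M0 delta_le mM (fun t => taylorP s t Ss)
  (has_moment_taylor2 m Ss bn0)
  (fun j => kdens_covariance Ss bn0 j j) (fun j => (c4P j).1).
have {}rem : `|\sum_(i < n) m (x n i) * w i - _| <= M * delta +
    e' * \sum_(j < d) kcov s (b n) j j + C * \sum_(j < d) c4 j := rem.
have bias := biasP s (b n) Ss b01.
set P0 := (m s + _ + _) in rem bias.
(* [P0] is the integral of the Taylor polynomial against the kernel: the first difference is the
   discretisation and Taylor error, the second the bias of the polynomial. *)
have -> : \sum_(i < n) m (x n i) * w i - m s - b n * gm_bias_coef m s =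
    (\sum_(i < n) m (x n i) * w i - P0) + (P0 - m s - b n * gm_bias_coef m s) by ring.
apply: le_trans (ler_normD _ _) _; apply: le_trans (lerD rem bias) _.
have h1 : M * delta <= e / 4 * b n.
  apply: (@le_trans _ _ (M * (d%:R * `|Cd|) * (k * b n))).
    have -> : M * delta = M * (d%:R * `|Cd|) * n%:R `^ (- d%:R^-1) by rewrite /delta !mulrA.
    by rewrite ler_wpM2l ?mulr_ge0.
  rewrite mulrA ler_wpM2r ?(ltW bn0)// /k mulrCA ler_piMr ?(ltW e40)//.
  by rewrite ler_pdivrMr ?mul1r ?lerDl// ltr_wpDl// !mulr_ge0.
have h2 : e' * \sum_(j < d) kcov s (b n) j j <= e / 4 * b n + e' * d%:R * A2 * b n ^+ 2.
  apply: (@le_trans _ _ (e' * (d%:R * (b n + A2 * b n ^+ 2)))).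
    rewrite ler_wpM2l ?(ltW e'0)// mulr_natl -[X in _ *+ X](card_ord d) -sumr_const.
    by apply: ler_sum => j _; exact: covP.
  by rewrite mulrA mulrDr !mulrA lerD2r ler_wpM2r ?(ltW bn0).
have h4 : C * \sum_(j < d) c4 j <= C * (d%:R * A4) * b n ^+ 2.
  rewrite -mulrA ler_wpM2l// -mulrA mulr_natl -[X in _ *+ X](card_ord d) -sumr_const.
  by apply: ler_sum => j _; have [] := c4P j.
have hK : K * b n ^+ 2 <= e / 4 * b n.
  rewrite expr2 mulrA ler_wpM2r ?(ltW bn0)//.
  move: bnK; rewrite ltr_pdivlMr ?ltr_wpDl// => bnK.
  by apply: le_trans (ltW bnK); rewrite mulrC ler_wpM2l ?(ltW bn0)// lerDl.
have eb0 : 0 <= e / 4 * b n by rewrite mulr_ge0 ?(ltW e40) ?(ltW bn0).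
have -> : e * b n = e / 4 * b n + e / 4 * b n + e / 4 * b n + e / 4 * b n by field.
rewrite /K !mulrDl in hK; lra.
Unshelve. all: by end_near.
Qed.
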